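(* Let $p\ge1$, let $g_2,\dots,g_{2p}$ be real with $g_{2p}>0$, $V(\lambda)=\sum_{j=1}^pg_{2j}\lambda^j$, $V_\lambda=dV/d\lambda$. Let $r_{\mathrm c}>0$ and $w_{\mathrm c}(\lambda)=\sqrt{\lambda(\lambda-4r_{\mathrm c})}$ (branch analytic in $|\lambda|>4r_{\mathrm c}$ with $w_{\mathrm c}\sim\lambda$ at infinity), and write $\oint$ for $\oint_{|\lambda|=R}\frac{d\lambda}{2\pi i}$ with $R>4r_{\mathrm c}$, positively oriented. Let $m\ge1$ and assume $$\oint\frac{V_\lambda}{w_{\mathrm c}}=0,\qquad \oint\frac{(\lambda-4r_{\mathrm c})^{k+1}V_\lambda}{w_{\mathrm c}^{2k+1}}=0\ (k=1,\dots,m-1),$$ $$\varphi_m:=\oint\frac{(\lambda-4r_{\mathrm c})^{m+1}V_\lambda}{w_{\mathrm c}^{2m+1}}\neq0,\qquad \oint\frac{\lambda^2V_\lambda}{w_{\mathrm c}^{3}}\neq0,$$ and set $T_{\mathrm c}=\oint\lambda V_\lambda/w_{\mathrm c}$. Let $I\subset\mathbb{R}$ be an open interval and let $\mathfrak a(\bar\epsilon,x)=r_{\mathrm c}+\sum_{k\ge1}\mathfrak a_k(x)\bar\epsilon^k$ and $\mathbb V(\lambda,\bar\epsilon;x)=\sum_{k\ge0}\mathbb V^{[k]}(\lambda,x)\bar\epsilon^k$ be formal power series in $\bar\epsilon$, with $\mathfrak a_k\in C^\infty(I)$, each $\mathbb V^{[k]}$ analytic in $\lambda$ for $|\lambda|>4r_{\mathrm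 c}$ and $C^\infty$ in $x$, and $\mathbb V^{[0]}=\lambda/w_{\mathrm c}$, such that, as formal power series in $\bar\epsilon$ and for all $x\in I$, $$\mathfrak a(\bar\epsilon,x)\big(\mathbb V(\lambda,\bar\epsilon;x)+\mathbb V(\lambda,-\bar\epsilon;x-\bar\epsilon)\big)\big(\mathbb V(\lambda,\bar\epsilon;x)+\mathbb V(\lambda,-\bar\epsilon;x+\bar\epsilon)\big)=\lambda\big(\mathbb V(\lambda,\bar\epsilon;x)^2-1\big)$$ and $$\oint V_\lambda(\lambda)\,\mathbb V(\lambda,\bar\epsilon;x)=T_{\mathrm c}+\bar\epsilon^{2m}x.$$ Then $u=\mathfrak a_1$ satisfies on $I$ the ordinary differential equation $$2r_{\mathrm c}\,\varphi_m\,R_m(u)+x\,u=0,$$ where the differential polynomials $R_j,S_j$ in $u$ are defined by $$R_0=-\frac{u}{2r_{\mathrm c}},\qquad S_0=-\frac{u^2}{8r_{\mathrm c}^2},\qquad R_{j+1}=-r_{\mathrm c}\,\partial_x^2R_j+2u\,S_j,\qquad 2r_{\mathrm c}\,\partial_xS_{j+1}=u\,\partial_xR_{j+1},$$ with $S_{j+1}$ taken without constant term.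
   Context: Shifted and sign-reversed series are understood formally: for $F(\bar\epsilon;x)=\sum_kF_k(x)\bar\epsilon^k$ and constants $c$, $F(\pm\bar\epsilon;x+c\bar\epsilon)=\sum_{k,n}(\pm1)^kF_k^{(n)}(x)c^n\bar\epsilon^{k+n}/n!$; equalities of formal series mean equality of coefficients of each power of $\bar\epsilon$. The contour integral over a large positively oriented circle equals the coefficient of $\lambda^{-1}$ in the expansion at $\lambda=\infty$. The hypotheses on the contour integrals express that the potential $V/T_{\mathrm c}$ is a critical model with a merging of two cuts of order $m$, and $(\mathfrak a,\mathbb V)$ describes a symmetric solution of the double-scaled string equations. The equation $2r_{\mathrm c}\varphi_mR_m(u)+xu=0$ is the $m$-th member of the Painlevé II hierarchy (for $m=1$: $R_1=\tfrac12u_{xx}-u^3/(4r_{\mathrm c}^2)$). *)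

(* Defs.v *)
From Stdlib Require Import Reals Arith.
From Coquelicot Require Import Coquelicot.
Open Scope R_scope.

(* principal square root of a complex number (branch cut on (-oo,0)) *)
Definition Csqrt (z : C) : C :=
  (sqrt ((Cmod z + Re z) / 2),
   if Rlt_dec (Im z) 0 then - sqrt ((Cmod z - Re z) / 2)
   else sqrt ((Cmod z - Re z) / 2)).

(* w_c(lambda) = sqrt(lambda (lambda - 4 r_c)), the branch analytic in
   |lambda| > 4 r_c with w_c ~ lambda at infinity:  lambda * sqrt(1 - 4 r_c/lambda)
   with the principal square root (1 - 4r_c/lambda has positive real part there). *)
Definition wc (rc : R) (l : C) : C := (l * Csqrt (1 - RtoC (4 * rc) / l))%C.

(* oint_{|lambda| = Rad} f(lambda) dlambda / (2 pi i), positively oriented: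
   with lambda = Rad e^{it}, dlambda/(2 pi i) = lambda dt / (2 pi). *)
Definition oint (Rad : R) (f : C -> C) : C :=
  (RtoC (/ (2 * PI)) *
   @RInt C_R_CompleteNormedModule
     (fun t => let z : C := ((Rad * cos t)%R, (Rad * sin t)%R) in (f z * z)%C) 0 (2 * PI))%C.

(* V(lambda) = sum_{j=1}^p g2 j lambda^j  (g2 j stands for g_{2j}),
   and its derivative V_lambda = sum_{j=1}^p j g2 j lambda^(j-1). *)
Definition Vpot (p : nat) (g2 : nat -> R) (l : C) : C :=
  sum_n (fun j => (RtoC (g2 (S j)) * l ^ (S j))%C) (p - 1).
Definition Vlam (p : nat) (g2 : nat -> R) (l : C) : C :=
  sum_n (fun j => (RtoC (INR (S j) * g2 (S j)) * l ^ j)%C) (p - 1).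

Definition CDerive_n (f : R -> C) (n : nat) (x : R) : C :=
  (Derive_n (fun y => Re (f y)) n x, Derive_n (fun y => Im (f y)) n x).

Definition smooth_on (I : R -> Prop) (f : R -> R) : Prop :=
  forall n x, I x -> ex_derive_n f n x.
Definition Csmooth_on (I : R -> Prop) (f : R -> C) : Prop :=
  smooth_on I (fun y => Re (f y)) /\ smooth_on I (fun y => Im (f y)).

Definition Iopen (a b : Rbar) (x : R) : Prop :=
  Rbar_lt a x /\ Rbar_lt x b.

(* Coefficient of eps^N in  VV(lambda, s*eps; x + c*eps)
   = sum_{k+n=N} s^k c^n / n! d_x^n VV^[k](lambda,x). *)
Definition shift_coef (VV : nat -> C -> R -> C) (s c : R) (N : nat) (l : C) (x : R) : C :=
  sum_n (fun k => (RtoC (s ^ k * c ^ (N - k) / INR (fact (N - k)))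
                   * CDerive_n (fun y => VV k l y) (N - k) x)%C) N.

Definition lhs_coef (a : nat -> R -> R) (VV : nat -> C -> R -> C)
    (N : nat) (l : C) (x : R) : C :=
  sum_n (fun i => sum_n (fun j =>
     (RtoC (a i x)
      * (VV j l x + shift_coef VV (-1) (-1) j l x)
      * (VV (N - i - j)%nat l x + shift_coef VV (-1) 1 (N - i - j)%nat l x))%C)
     (N - i)) N.

Definition rhs_coef (VV : nat -> C -> R -> C) (N : nat) (l : C) (x : R) : C :=
  (l * (sum_n (fun i => (VV i l x * VV (N - i)%nat l x)%C) N
        - (if Nat.eqb N 0 then 1 else 0)))%C.

(* polynomials with real coefficients in the jet variables u, u', u'', ...
   (dV i stands for the i-th derivative of u) *)
Inductive dpoly : Type :=
| dC : R -> dpoly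
| dV : nat -> dpoly
| dAdd : dpoly -> dpoly -> dpoly
| dMul : dpoly -> dpoly -> dpoly.

Fixpoint deval (P : dpoly) (s : nat -> R) : R :=
  match P with
  | dC c => c
  | dV i => s i
  | dAdd P Q => deval P s + deval Q s
  | dMul P Q => deval P s * deval Q s
  end.

Fixpoint dD (P : dpoly) : dpoly :=
  match P with
  | dC _ => dC 0
  | dV i => dV (S i)
  | dAdd P Q => dAdd (dD P) (dD Q)
  | dMul P Q => dAdd (dMul (dD P) Q) (dMul P (dD Q))
  end.

(* (Rs, Ss) are the differential polynomials R_j, S_j of the statement.
   Equality of differential polynomials = equality of the polynomial functions
   on all jets; the constant term of P is deval P (fun _ => 0). *)
Definition RS_sequences (rc : R) (Rs Ss : nat -> dpoly) : Prop :=
  (forall s, deval (Rs 0%nat) s = - s 0%nat / (2 * rc)) /\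
  (forall s, deval (Ss 0%nat) s = - (s 0%nat) ^ 2 / (8 * rc ^ 2)) /\
  (forall j s, deval (Rs (S j)) s
               = - rc * deval (dD (dD (Rs j))) s + 2 * s 0%nat * deval (Ss j) s) /\
  (forall j s, 2 * rc * deval (dD (Ss (S j))) s = s 0%nat * deval (dD (Rs (S j))) s) /\
  (forall j, deval (Ss (S j)) (fun _ => 0) = 0).

Definition jet (u : R -> R) (x : R) : nat -> R := fun i => Derive_n u i x.

(* Main.v *)
Require Import Defs.
From Stdlib Require Import Reals Lra Lia Arith.
From Coquelicot Require Import Coquelicot.
Open Scope R_scope.

(* Divide the resolvent coefficients by [VV^[0] = l/w_c]. The resulting [F_k]
   are rational in [1/l], with poles only at [l = 0] and [l = 4 rc]; as long as
   the orders below [N] have no pole at [4 rc], order [N] has at most a simple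
   one, and only for even [N]. In an order below [2m] the string equation
   pairs [V_lambda] with [F_N]; the criticality conditions kill all powers
   [1/l^k], [1 <= k <= m], so the residue at [4 rc] must vanish. Orders [2m]
   and [2m+1] are the first ones to see [x], respectively the moment of
   [1/l^(m+1)], which is [- phi_m / (4 rc)].
   The highest powers of [1/l] in [F_(2k)] and [F_(2k+1)] have degrees [k] and
   [k+1] and coefficients [s_k], [r_k] for which the string equation reduces to
   two convolution identities in [x]. The rescaled [S_(k-1)], [R_k] satisfy
   these identities, hence are the leading coefficients, and pairing
   [V_lambda] with [F_(2m+1)] gives the equation. *)

(* Coquelicot states equations in the carrier of an algebraic structure, which
   [ring] does not recognize as a ring. *)
Ltac ring_in T := match goal with |- ?u = ?v => change (@eq T u v) end; ring.

(** * Differential polynomials and the recursion *)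

(** The parity pattern comes from the brackets F(eps; x) + F(-eps; x +- eps), which contain F_N in
    order N with the factor 1 + (-1)^N. For odd N it cancels on the left, and the string equation
    yields l F_N without division. For even N the difference of the two sides contains 2 (l - 4 rc)
    F_N, and dividing by this factor is what creates a pole. Leading coefficients are identified by
    comparison. A trial F_N with the predicted leading term is inserted. The convolution identities
    make the top coefficient of its defect vanish, and the defect responds linearly to a change of
    F_N alone, so the true F_N has the same leading coefficient. The a_k with k >= 2 only multiply
    orders of too low a degree, hence only rc and u = a_1 reach the final equation. The identity for
    even orders does not follow from the recursion by algebra: it is a first integral. It rests on
    the fact that a differential polynomial with zero total derivative is constant. *)

Lemma sum_n_head {G : AbelianMonoid} (f : nat -> G) (N : nat) :
  sum_n f (S N) = plus (f 0%nat) (sum_n (fun j => f (S j)) N).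
Proof.
  induction N as [|N IH].
  - now rewrite sum_Sn, !sum_O.
  - now rewrite sum_Sn, IH, (sum_Sn (fun j => f (S j))), plus_assoc.
Qed.

Lemma sum_n_rev {G : AbelianMonoid} (f : nat -> G) (N : nat) :
  sum_n f N = sum_n (fun j => f (N - j)%nat) N.
Proof.
  revert f; induction N as [|N IH]; intros f.
  - now rewrite !sum_O.
  - rewrite sum_Sn, sum_n_head, plus_comm, IH; reflexivity.
Qed.

(** The summand is a function of both indices, so that two convolutions can be compared after
    symmetrising in them. *)
Definition csum (F : nat -> nat -> R) (K : nat) : R :=
  sum_n (fun j => F j (K - j)%nat) K.

Lemma csum_ext (F G : nat -> nat -> R) (K : nat) :
  (forall j l, F j l = G j l) -> csum F K = csum G K.
Proof. intros H; apply sum_n_ext; intros; apply H. Qed.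

Lemma csum_flip (F : nat -> nat -> R) (K : nat) :
  csum F K = csum (fun j l => F l j) K.
Proof.
  unfold csum; rewrite sum_n_rev; apply sum_n_ext_loc; intros j Hj.
  now replace (K - (K - j))%nat with j by lia.
Qed.

Lemma csum_plus (F G : nat -> nat -> R) (K : nat) :
  csum (fun j l => F j l + G j l) K = csum F K + csum G K.
Proof. exact (sum_n_plus _ _ K). Qed.

Lemma csum_scal (c : R) (F : nat -> nat -> R) (K : nat) :
  csum (fun j l => c * F j l) K = c * csum F K.
Proof. exact (sum_n_mult_l c _ K). Qed.

(** Reversing the sum shows that a convolution sees only the symmetric part of its summand. *)
Lemma csum_sym (F G : nat -> nat -> R) (K : nat) :
  (forall j l, F j l + F l j = G j l + G l j) -> csum F K = csum G K.
Proof.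
  intros H.
  assert (E : csum (fun j l => F j l + F l j) K = csum (fun j l => G j l + G l j) K)
    by now apply csum_ext.
  rewrite !csum_plus, <- (csum_flip F), <- (csum_flip G) in E; lra.
Qed.

Lemma csum_shift (F : nat -> nat -> R) (K : nat) :
  (forall l, F 0%nat l = 0) -> csum F (S K) = csum (fun j l => F (S j) l) K.
Proof.
  intros H; unfold csum; rewrite sum_n_head, H.
  exact (plus_zero_l _).
Qed.

(** The differential of the polynomial function at [s] in the direction [h]. The total derivative
    [dD] is the case where [h] is the shifted jet. *)
Fixpoint ddir (P : dpoly) (s h : nat -> R) : R :=
  match P with
  | dC _ => 0
  | dV i => h i
  | dAdd P Q => ddir P s h + ddir Q s h
  | dMul P Q => ddir P s h * deval Q s + deval P s * ddir Q s h
  end.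

Lemma dD_ddir (P : dpoly) (s : nat -> R) :
  deval (dD P) s = ddir P s (fun i => s (S i)).
Proof.
  induction P as [c|i|P IHP Q IHQ|P IHP Q IHQ]; simpl; rewrite ?IHP, ?IHQ; reflexivity.
Qed.

Lemma ddir_plus_scal (P : dpoly) (s h k : nat -> R) (c : R) :
  ddir P s (fun i => h i + c * k i) = ddir P s h + c * ddir P s k.
Proof.
  induction P as [d|i|P IHP Q IHQ|P IHP Q IHQ]; simpl; rewrite ?IHP, ?IHQ; ring.
Qed.

Lemma is_derive_deval (P : dpoly) (c : nat -> R -> R) (c' : nat -> R) (t : R) :
  (forall i, is_derive (c i) t (c' i)) ->
  is_derive (fun t => deval P (fun i => c i t)) t (ddir P (fun i => c i t) c').
Proof.
  intros H; induction P as [d|i|P IHP Q IHQ|P IHP Q IHQ]; simpl.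
  - exact (is_derive_const d t).
  - apply H.
  - exact (is_derive_plus _ _ _ _ _ IHP IHQ).
  - exact (is_derive_mult _ _ _ _ _ IHP IHQ Rmult_comm).
Qed.

Lemma deval_ext (P : dpoly) (s s' : nat -> R) :
  (forall i, s i = s' i) -> deval P s = deval P s'.
Proof.
  intros H; induction P as [d|i|P IHP Q IHQ|P IHP Q IHQ]; simpl; rewrite ?IHP, ?IHQ; auto.
Qed.

Lemma ddir_ext (P : dpoly) (s s' h : nat -> R) :
  (forall i, s i = s' i) -> ddir P s h = ddir P s' h.
Proof.
  intros H; induction P as [d|i|P IHP Q IHQ|P IHP Q IHQ]; simpl;
    rewrite ?IHP, ?IHQ, ?(deval_ext P s s' H), ?(deval_ext Q s s' H); auto.
Qed.

Lemma is_derive_line (P : dpoly) (s h : nat -> R) (t : R) :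
  is_derive (fun t => deval P (fun i => s i + t * h i)) t
            (ddir P (fun i => s i + t * h i) h).
Proof.
  apply (is_derive_deval P (fun i t => s i + t * h i)); intros i.
  auto_derive; [exact I | ring].
Qed.

(** Both sides are derivatives at [t = 0] of the same function on a line. This passes from equal
    values to equal derivatives even when [P] and [Q] are different terms, where structural
    induction has nothing to work on. *)
Lemma ddir_locality (P Q : dpoly) (s s' h h' : nat -> R) :
  (forall t, deval P (fun i => s i + t * h i) = deval Q (fun i => s' i + t * h' i)) ->
  ddir P s h = ddir Q s' h'.
Proof.
  intros H.
  assert (A : forall i, s i = s i + 0 * h i) by (intros; ring).
  assert (B : forall i, s' i = s' i + 0 * h' i) by (intros; ring).
  rewrite (ddir_ext P _ _ h A), (ddir_ext Q _ _ h' B).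
  rewrite <- (is_derive_unique _ _ _ (is_derive_line P s h 0)),
          <- (is_derive_unique _ _ _ (is_derive_line Q s' h' 0)).
  now apply Derive_ext.
Qed.

Lemma dD_ext (P Q : dpoly) :
  (forall s, deval P s = deval Q s) -> forall s, deval (dD P) s = deval (dD Q) s.
Proof.
  intros H s; rewrite !dD_ddir; apply ddir_locality; intros; apply H.
Qed.

(** Dependence is semantic: a term may contain [dV n] although its value does not depend on it. Thus
    the bound can be lowered without changing [P]. *)
Definition depends_below (P : dpoly) (n : nat) : Prop :=
  forall s s', (forall i, (i < n)%nat -> s i = s' i) -> deval P s = deval P s'.

Lemma depends_below_exists (P : dpoly) : exists n, depends_below P n.
Proof.
  induction P as [d|i|P [n IHP] Q [k IHQ]|P [n IHP] Q [k IHQ]].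
  - exists 0%nat; intros s s' _; reflexivity.
  - exists (S i); intros s s' H; apply H; lia.
  - exists (max n k); intros s s' H; simpl.
    rewrite (IHP s s'), (IHQ s s'); auto; intros; apply H; lia.
  - exists (max n k); intros s s' H; simpl.
    rewrite (IHP s s'), (IHQ s s'); auto; intros; apply H; lia.
Qed.

Definition unit_jet (n i : nat) : R := if Nat.eqb i n then 1 else 0.

(* [dD P] is affine in the first jet variable absent from [P], with slope the
   partial derivative of [P] in its last variable. *)
Lemma dD_zero_depends (P : dpoly) (n : nat) :
  (forall s, deval (dD P) s = 0) -> depends_below P (S n) -> depends_below P n.
Proof.
  intros H HP.
  assert (Z : forall s, ddir P s (unit_jet n) = 0).
  { intros s.
    pose (s1 := fun i => s i + 1 * unit_jet (S n) i).
    assert (E : ddir P s1 (fun i => s1 (S i))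
                = ddir P s (fun i => s (S i) + 1 * unit_jet n i)).
    { apply ddir_locality; intros t; apply HP; intros i Hi; unfold s1, unit_jet.
      destruct (Nat.eqb_spec i (S n)); [lia|].
      destruct (Nat.eqb_spec (S i) (S n)), (Nat.eqb_spec i n); try lia; ring. }
    rewrite ddir_plus_scal, <- !dD_ddir, !H in E; lra. }
  intros s s' Hs.
  assert (L : forall t, deval P (fun i => s i + t * unit_jet n i)
                        = deval P (fun i => s i + 0 * unit_jet n i)).
  { intros t; destruct (MVT_gen (fun t => deval P (fun i => s i + t * unit_jet n i)) 0 t
      (fun _ => 0)) as [c [_ Hc]].
    - intros y _. rewrite <- (Z (fun i => s i + y * unit_jet n i)).
      apply is_derive_line.
    - intros y _. apply continuity_pt_filterlim.
      apply (ex_derive_continuous (fun t => deval P (fun i => s i + t * unit_jet n i))).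
      eexists; apply is_derive_line.
    - lra. }
  transitivity (deval P (fun i => s i + 0 * unit_jet n i)).
  { apply deval_ext; intros; ring. }
  rewrite <- (L (s' n - s n)).
  apply HP; intros i Hi; unfold unit_jet.
  destruct (Nat.eqb_spec i n) as [->|]; [ring|].
  rewrite Hs by lia; ring.
Qed.

(** A term involves finitely many jet variables, and [dD_zero_depends] removes the highest one
    repeatedly until none is left. *)
Lemma dD_zero_const (P : dpoly) :
  (forall s, deval (dD P) s = 0) -> forall s, deval P s = deval P (fun _ => 0).
Proof.
  intros H s.
  destruct (depends_below_exists P) as [n Hn].
  assert (H0 : depends_below P 0).
  { induction n as [|n IH]; [assumption|]. now apply IH, dD_zero_depends. }
  apply H0; lia.
Qed.

Lemma deval_dD_at_0 (P : dpoly) : deval (dD P) (fun _ => 0) = 0.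
Proof.
  induction P as [d|i|P IHP Q IHQ|P IHP Q IHQ]; simpl; rewrite ?IHP, ?IHQ; ring.
Qed.

(** Sums as terms, because [dD] and [dD_zero_const] act on terms and not on polynomial functions. *)
Fixpoint dsum (f : nat -> dpoly) (N : nat) : dpoly :=
  match N with
  | O => f 0%nat
  | S N => dAdd (dsum f N) (f (S N))
  end.

Lemma deval_dsum (f : nat -> dpoly) (N : nat) (s : nat -> R) :
  deval (dsum f N) s = sum_n (fun j => deval (f j) s) N.
Proof.
  induction N as [|N IH]; [now rewrite sum_O|].
  rewrite sum_Sn; simpl; now rewrite IH.
Qed.

Lemma deval_dD_dsum (f : nat -> dpoly) (N : nat) (s : nat -> R) :
  deval (dD (dsum f N)) s = sum_n (fun j => deval (dD (f j)) s) N.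
Proof.
  induction N as [|N IH]; [now rewrite sum_O|].
  rewrite sum_Sn; simpl; now rewrite IH.
Qed.

(* [s] and [r] below are the rescaled sequences [-4 rc S_{k-1}] (with
   [S_{-1} = -1/(4 rc)]) and [-4 rc R_k]; they turn out to be the leading
   coefficients of the even and odd orders of the resolvent at [lambda = 0]. *)
Section Hierarchy.

Variables (rc : R) (Rs Ss : nat -> dpoly).
Hypothesis Hrc : 0 < rc.
Hypothesis HRS : RS_sequences rc Rs Ss.

Definition sP (k : nat) : dpoly :=
  match k with O => dC 1 | S k => dMul (dC (- 4 * rc)) (Ss k) end.
Definition rP (k : nat) : dpoly := dMul (dC (- 4 * rc)) (Rs k).
(** The shift of [rP] by one index, with 0 in place of R_{-1}: [rhoP i] belongs to order [2i-1] of
    the resolvent, whose [x]-derivative enters the string equation next to order [2i]. *)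
Definition rhoP (k : nat) : dpoly :=
  match k with O => dC 0 | S k => rP k end.

Lemma sP_D (j : nat) (s : nat -> R) :
  2 * rc * deval (dD (sP j)) s = s 0%nat * deval (dD (rhoP j)) s.
Proof.
  destruct HRS as (HR0 & HS0 & _ & HS & _).
  destruct j as [|[|j]]; simpl.
  - ring.
  (* The differential relation is assumed only from index 1 on, so for R_0 and S_0 it is computed.
     As [dD] acts on terms and only the values of these two are known, explicit terms with the same
     values replace them. *)
  - pose (QR := dMul (dC (- / (2 * rc))) (dV 0)).
    pose (QS := dMul (dC (- / (8 * rc ^ 2))) (dMul (dV 0) (dV 0))).
    rewrite (dD_ext (Rs 0%nat) QR), (dD_ext (Ss 0%nat) QS); simpl.
    + field; lra.
    + intros; rewrite HS0; field; lra.
    + intros; rewrite HR0; field; lra.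
  - specialize (HS j s).
    transitivity (-4 * rc * (2 * rc * deval (dD (Ss (S j))) s)); [ring|].
    rewrite HS; ring.
Qed.

(** The conventions [sP 0 = 1] and [rhoP 0 = 0] make the initial value R_0 an instance of the
    recursion. *)
Lemma rP_rec (j : nat) (s : nat -> R) :
  deval (rP j) s + rc * deval (dD (dD (rhoP j))) s
  = 2 * s 0%nat * deval (sP j) s.
Proof.
  destruct HRS as (HR0 & _ & HR & _).
  destruct j as [|j]; simpl.
  - rewrite HR0; field; lra.
  - rewrite HR; ring.
Qed.

Lemma RS_at_0 (j : nat) :
  deval (Rs j) (fun _ => 0) = 0 /\ deval (Ss j) (fun _ => 0) = 0.
Proof.
  destruct HRS as (HR0 & HS0 & HR & _ & HS).
  split; destruct j as [|j].
  - rewrite HR0; field; lra.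
  - rewrite HR, deval_dD_at_0; ring.
  - rewrite HS0; field; lra.
  - apply HS.
Qed.

(* The quadratic first integral of the recursion: its derivative vanishes by
   [sP_D] and [rP_rec], and it vanishes on the zero jet. *)
Lemma quadratic_integral (k : nat) (s : nat -> R) :
  csum (fun j l => 4 * rc * deval (sP j) s * deval (sP l) s
                   - rc * deval (dD (rhoP j)) s * deval (dD (rhoP l)) s) (S k)
  = csum (fun i l => deval (rP i) s * deval (rP l) s) k.
Proof.
  pose (T := fun j =>
    dAdd (dMul (dC (4 * rc)) (dMul (sP j) (sP (S k - j))))
         (dMul (dC (- rc)) (dMul (dD (rhoP j)) (dD (rhoP (S k - j)))))).
  pose (U := fun i => dMul (rP i) (rP (k - i))).
  pose (P := dAdd (dsum T (S k)) (dMul (dC (-1)) (dsum U k))).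
  assert (E : forall s, deval P s =
    csum (fun j l => 4 * rc * deval (sP j) s * deval (sP l) s
                   - rc * deval (dD (rhoP j)) s * deval (dD (rhoP l)) s) (S k)
    - csum (fun i l => deval (rP i) s * deval (rP l) s) k).
  { clear s; intros s; unfold P, T, U.
    change (deval (dsum T (S k)) s + (-1) * deval (dsum U k) s =
      csum (fun j l => 4 * rc * deval (sP j) s * deval (sP l) s
                   - rc * deval (dD (rhoP j)) s * deval (dD (rhoP l)) s) (S k)
      - csum (fun i l => deval (rP i) s * deval (rP l) s) k).
    rewrite !deval_dsum.
    replace (csum (fun j l => 4 * rc * deval (sP j) s * deval (sP l) s
                   - rc * deval (dD (rhoP j)) s * deval (dD (rhoP l)) s) (S k))
      with (sum_n (fun j => deval (T j) s) (S k)).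
    - change (sum_n (fun j => deval (U j) s) k)
        with (csum (fun i l => deval (rP i) s * deval (rP l) s) k); ring.
    - unfold csum; apply sum_n_ext; intros j; unfold T; cbn [deval]; ring_in R. }
  assert (DP : forall s, deval (dD P) s = 0).
  { clear s E; intros s; unfold P.
    change (deval (dD (dsum T (S k))) s
            + (0 * deval (dsum U k) s + -1 * deval (dD (dsum U k)) s) = 0).
    rewrite !deval_dD_dsum.
    assert (EU : sum_n (fun j => deval (dD (U j)) s) k
       = csum (fun j l => 2 * deval (dD (rhoP j)) s * deval (rP l) s) (S k)).
    { rewrite csum_shift by (intros; simpl; ring).
      change (csum (fun i l => deval (dD (dMul (rP i) (rP l))) s) k
        = csum (fun j l => 2 * deval (dD (rP j)) s * deval (rP l) s) k).
      apply csum_sym; intros; simpl deval; ring. }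
    assert (ET : sum_n (fun j => deval (dD (T j)) s) (S k)
       = csum (fun j l => 2 * deval (dD (rhoP j)) s * deval (rP l) s) (S k)).
    { change (csum (fun j l => deval (dD
          (dAdd (dMul (dC (4 * rc)) (dMul (sP j) (sP l)))
            (dMul (dC (- rc)) (dMul (dD (rhoP j)) (dD (rhoP l)))))) s) (S k)
        = csum (fun j l => 2 * deval (dD (rhoP j)) s * deval (rP l) s) (S k)).
      (* With s' rewritten by [sP_D] and r by [rP_rec], both symmetrised summands equal 4 u (rho_j'
         s_l + rho_l' s_j) - 2 rc (rho_j' rho_l')'. *)
      apply csum_sym; intros j l.
      assert (X1 := sP_D j s); assert (X2 := sP_D l s).
      assert (Y1 := rP_rec j s); assert (Y2 := rP_rec l s).
      cbn [deval dD].
      replace (deval (rP j) s) with (2 * s 0%nat * deval (sP j) s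
         - rc * deval (dD (dD (rhoP j))) s) by lra.
      replace (deval (rP l) s) with (2 * s 0%nat * deval (sP l) s
         - rc * deval (dD (dD (rhoP l))) s) by lra.
      transitivity (4 * (2 * rc * deval (dD (sP j)) s) * deval (sP l) s
        + 4 * (2 * rc * deval (dD (sP l)) s) * deval (sP j) s
        - 2 * rc * (deval (dD (dD (rhoP j))) s * deval (dD (rhoP l)) s
                    + deval (dD (dD (rhoP l))) s * deval (dD (rhoP j)) s)); [ring|].
      rewrite X1, X2; ring. }
    rewrite EU, ET; ring. }
  (* On the zero jet all [rP i] vanish, and so do all [sP j] except [sP 0]. Since the indices of the
     first convolution add up to [S k > 0], each of its products has a zero factor. *)
  assert (Z : deval P (fun _ => 0) = 0).
  { rewrite E. unfold csum.
    rewrite (sum_n_ext_loc _ (fun _ => 0)), (sum_n_ext_loc (fun j : nat => deval (rP j) _ * _) (fun _ => 0)).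
    - rewrite !sum_n_const; ring.
    - intros i _; simpl; destruct (RS_at_0 i) as [-> _]; ring.
    - intros j Hj; rewrite !deval_dD_at_0.
      destruct j as [|j].
      + simpl; destruct (RS_at_0 k) as [_ ->]; ring.
      + simpl; destruct (RS_at_0 j) as [_ ->]; ring. }
  specialize (E s); rewrite (dD_zero_const P DP s), Z in E; lra.
Qed.

(** Counterpart of [quadratic_integral] for odd orders. It holds term by term: [sP_D] cancels the
    products rho_j' rho_l', and [rP_rec] collects the rest into 2 r_j s_l. *)
Lemma linear_integral (K : nat) (s : nat -> R) :
  csum (fun j l => s 0%nat * (4 * deval (sP j) s * deval (sP l) s
                              - deval (dD (rhoP j)) s * deval (dD (rhoP l)) s)
                   + rc * (2 * deval (dD (sP j)) s * deval (dD (rhoP l)) s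
                           - 2 * deval (dD (dD (rhoP j))) s * deval (sP l) s)) K
  = csum (fun j l => 2 * deval (rP j) s * deval (sP l) s) K.
Proof.
  apply csum_ext; intros j l.
  assert (X := sP_D j s); assert (Y := rP_rec j s).
  replace (deval (rP j) s) with (2 * s 0%nat * deval (sP j) s
    - rc * deval (dD (dD (rhoP j))) s) by lra.
  transitivity (s 0%nat * (4 * deval (sP j) s * deval (sP l) s
                              - deval (dD (rhoP j)) s * deval (dD (rhoP l)) s)
     + (2 * rc * deval (dD (sP j)) s) * deval (dD (rhoP l)) s
     - 2 * rc * deval (dD (dD (rhoP j))) s * deval (sP l) s); [ring|].
  rewrite X; ring.
Qed.

End Hierarchy.

(** * Laurent polynomials with smooth coefficients *)

Lemma Iopen_locally (a b : Rbar) (x : R) : Iopen a b x -> locally x (Iopen a b).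
Proof.
  intros [Ha Hb]; apply filter_and.
  - now apply (open_Rbar_gt' x a).
  - now apply (open_Rbar_lt' x b).
Qed.

Section Smooth.

Variables (a b : Rbar).
Notation I := (Iopen a b).

Lemma smooth_on_ext (f g : R -> R) :
  (forall x, I x -> f x = g x) -> smooth_on I f -> smooth_on I g.
Proof.
  intros H Hf n x Hx; apply (ex_derive_n_ext_loc f); [|now apply Hf].
  apply (filter_imp I); [assumption | now apply Iopen_locally].
Qed.

Lemma Derive_n_ext_on (f g : R -> R) (n : nat) (x : R) :
  (forall y, I y -> f y = g y) -> I x -> Derive_n f n x = Derive_n g n x.
Proof.
  intros H Hx; apply Derive_n_ext_loc.
  apply (filter_imp I); [assumption | now apply Iopen_locally].
Qed.

Lemma smooth_on_locally (f : R -> R) (n : nat) (x : R) :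
  smooth_on I f -> I x ->
  locally x (fun y => forall k, (k <= n)%nat -> ex_derive_n f k y).
Proof.
  intros H Hx; apply (filter_imp I); [|now apply Iopen_locally].
  intros y Hy k _; now apply H.
Qed.

Lemma smooth_on_const (c : R) : smooth_on I (fun _ => c).
Proof. intros n x _; apply ex_derive_n_const. Qed.

Lemma smooth_on_plus (f g : R -> R) :
  smooth_on I f -> smooth_on I g -> smooth_on I (fun x => f x + g x).
Proof. intros Hf Hg n x Hx; apply ex_derive_n_plus; now apply smooth_on_locally. Qed.

Lemma Derive_n_plus_on (f g : R -> R) (n : nat) (x : R) :
  smooth_on I f -> smooth_on I g -> I x ->
  Derive_n (fun y => f y + g y) n x = Derive_n f n x + Derive_n g n x.
Proof. intros Hf Hg Hx; apply Derive_n_plus; now apply smooth_on_locally. Qed.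

Lemma smooth_on_scal (c : R) (f : R -> R) :
  smooth_on I f -> smooth_on I (fun x => c * f x).
Proof. intros Hf n x Hx; now apply ex_derive_n_scal_l, Hf. Qed.

Lemma smooth_on_Derive_n (f : R -> R) (k : nat) :
  smooth_on I f -> smooth_on I (Derive_n f k).
Proof.
  intros Hf [|n] x Hx; [exact Logic.I|].
  apply (ex_derive_ext (Derive_n f (n + k))).
  - intros y; now rewrite Derive_n_comp.
  - now apply (Hf (S (n + k))).
Qed.

Lemma smooth_on_mult (f g : R -> R) :
  smooth_on I f -> smooth_on I g -> smooth_on I (fun x => f x * g x).
Proof.
  intros Hf Hg n; revert f g Hf Hg.
  (* The induction carries all orders up to [n] on the whole interval, because [ex_derive_n_plus]
     asks for the lower orders in a neighbourhood of the point. *)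
  enough (H : forall f g, smooth_on I f -> smooth_on I g ->
     forall k, (k <= n)%nat -> forall x, I x -> ex_derive_n (fun y => f y * g y) k x).
  { intros f g Hf Hg x Hx; now apply (H f g Hf Hg n). }
  induction n as [|n IH]; intros f g Hf Hg k Hk x Hx.
  { now replace k with 0%nat by lia. }
  destruct k as [|k]; [exact Logic.I|].
  assert (D : forall y, I y -> Derive f y * g y + f y * Derive g y
                               = Derive_n (fun y => f y * g y) 1 y).
  { intros y Hy; symmetry; apply Derive_mult; [now apply (Hf 1%nat) | now apply (Hg 1%nat)]. }
  assert (Hf' := smooth_on_Derive_n f 1 Hf); assert (Hg' := smooth_on_Derive_n g 1 Hg).
  assert (E : ex_derive_n (fun y => Derive f y * g y + f y * Derive g y) k x).
  { apply ex_derive_n_plus; apply (filter_imp I); try (now apply Iopen_locally);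
      intros y Hy j Hj; apply IH; auto; lia. }
  assert (E' : ex_derive_n (Derive_n (fun y => f y * g y) 1) k x).
  { apply (ex_derive_n_ext_loc (fun y => Derive f y * g y + f y * Derive g y)); [|exact E].
    apply (filter_imp I); [exact D | now apply Iopen_locally]. }
  destruct k as [|k].
  - apply (ex_derive_mult f g); [now apply (Hf 1%nat) | now apply (Hg 1%nat)].
  - apply (ex_derive_ext (Derive_n (Derive_n (fun y => f y * g y) 1) k)).
    + intros y; rewrite Derive_n_comp; now replace (k + 1)%nat with (S k) by lia.
    + exact E'.
Qed.

Lemma Csmooth_on_ext (f g : R -> C) :
  (forall x, I x -> f x = g x) -> Csmooth_on I f -> Csmooth_on I g.
Proof.
  intros H [H1 H2]; split.
  - apply (smooth_on_ext (fun y => Re (f y))); [intros; now rewrite H | exact H1].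
  - apply (smooth_on_ext (fun y => Im (f y))); [intros; now rewrite H | exact H2].
Qed.

Lemma Csmooth_on_plus (f g : R -> C) :
  Csmooth_on I f -> Csmooth_on I g -> Csmooth_on I (fun x => (f x + g x)%C).
Proof. intros [F1 F2] [G1 G2]; split; now apply smooth_on_plus. Qed.

Lemma Csmooth_on_RtoC (f : R -> R) :
  smooth_on I f -> Csmooth_on I (fun x => RtoC (f x)).
Proof. intros H; split; [exact H | exact (smooth_on_const 0)]. Qed.

Lemma Csmooth_on_scal (f : R -> C) (c : C) :
  Csmooth_on I f -> Csmooth_on I (fun x => (c * f x)%C).
Proof.
  intros [F1 F2]; destruct c as [c1 c2]; split; simpl.
  - apply (smooth_on_ext (fun y => c1 * Re (f y) + - c2 * Im (f y))).
    + intros; unfold Re, Im; ring.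
    + apply smooth_on_plus; now apply smooth_on_scal.
  - apply (smooth_on_ext (fun y => c1 * Im (f y) + c2 * Re (f y))).
    + intros; unfold Re, Im; ring.
    + apply smooth_on_plus; now apply smooth_on_scal.
Qed.

Lemma CDerive_n_ext (f g : R -> C) (n : nat) (x : R) :
  (forall y, I y -> f y = g y) -> I x -> CDerive_n f n x = CDerive_n g n x.
Proof.
  intros H Hx; unfold CDerive_n; f_equal; apply Derive_n_ext_on; auto;
    intros y Hy; now rewrite H.
Qed.

Lemma CDerive_n_plus (f g : R -> C) (n : nat) (x : R) :
  Csmooth_on I f -> Csmooth_on I g -> I x ->
  CDerive_n (fun y => (f y + g y)%C) n x = (CDerive_n f n x + CDerive_n g n x)%C.
Proof.
  intros [F1 F2] [G1 G2] Hx; unfold CDerive_n, Cplus; simpl; f_equal;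
    now apply Derive_n_plus_on.
Qed.

Lemma CDerive_n_scal (f : R -> C) (c : C) (n : nat) (x : R) :
  Csmooth_on I f -> I x ->
  CDerive_n (fun y => (c * f y)%C) n x = (c * CDerive_n f n x)%C.
Proof.
  intros [F1 F2] Hx; destruct c as [c1 c2]; unfold CDerive_n, Cmult; simpl; f_equal.
  - rewrite (Derive_n_ext _ (fun y => c1 * Re (f y) + - c2 * Im (f y))).
    + rewrite Derive_n_plus_on, !Derive_n_scal_l by
        (try assumption; now apply smooth_on_scal); ring.
    + intros; unfold Re, Im; ring.
  - rewrite (Derive_n_ext _ (fun y => c1 * Im (f y) + c2 * Re (f y))).
    + rewrite Derive_n_plus_on, !Derive_n_scal_l by
        (try assumption; now apply smooth_on_scal); ring.
    + intros; unfold Re, Im; ring.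
Qed.

Lemma CDerive_n_RtoC (f : R -> R) (n : nat) (x : R) :
  CDerive_n (fun y => RtoC (f y)) n x = RtoC (Derive_n f n x).
Proof.
  unfold CDerive_n, RtoC; simpl; f_equal.
  destruct n as [|n]; [reflexivity | apply Derive_n_const].
Qed.

Lemma CDerive_n_0 (f : R -> C) (x : R) : CDerive_n f 0 x = f x.
Proof. unfold CDerive_n; simpl; symmetry; apply surjective_pairing. Qed.

End Smooth.

(* [Pol a b rc d t f]: for [|l| > 4 rc] and [x] in the interval, [f l x] is a
   polynomial of degree at most [d] in [1/l] with smooth coefficients in [x],
   the coefficient of [(1/l)^d] being [t]. *)
Fixpoint Pol (a b : Rbar) (rc : R) (d : nat) (t : R -> R) (f : C -> R -> C) : Prop :=
  match d with
  | O => smooth_on (Iopen a b) t /\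
         forall l x, 4 * rc < Cmod l -> Iopen a b x -> f l x = RtoC (t x)
  | S d => exists c g, smooth_on (Iopen a b) c /\ Pol a b rc d t g /\
         forall l x, 4 * rc < Cmod l -> Iopen a b x ->
           f l x = (RtoC (c x) + g l x / l)%C
  end.

Section Pol.

Variables (a b : Rbar) (rc : R).
Hypothesis Hrc : 0 < rc.
Notation I := (Iopen a b).
Notation pol := (Pol a b rc).

Lemma outside_nonzero (l : C) : 4 * rc < Cmod l -> l <> 0%C.
Proof. intros H ->; rewrite Cmod_0 in H; lra. Qed.

Lemma Pol_ext (d : nat) (t t' : R -> R) (f f' : C -> R -> C) :
  (forall x, I x -> t x = t' x) ->
  (forall l x, 4 * rc < Cmod l -> I x -> f l x = f' l x) ->
  pol d t f -> pol d t' f'.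
Proof.
  revert f f'; induction d as [|d IH]; intros f f' Ht Hf; simpl.
  - intros [S E]; split.
    + now apply (smooth_on_ext a b t).
    + intros l x Hl Hx; rewrite <- Hf, <- Ht; auto.
  - intros (c & g & Sc & Pg & E); exists c, g; repeat split; auto.
    + now apply (IH g g).
    + intros l x Hl Hx; rewrite <- Hf; auto.
Qed.

Lemma Pol_smooth (d : nat) (t : R -> R) (f : C -> R -> C) :
  pol d t f -> smooth_on I t.
Proof.
  revert f; induction d as [|d IH]; intros f; simpl.
  - now intros [S _].
  - intros (c & g & _ & Pg & _); now apply (IH g).
Qed.

Lemma Pol_Csmooth (d : nat) (t : R -> R) (f : C -> R -> C) (l : C) :
  pol d t f -> 4 * rc < Cmod l -> Csmooth_on I (f l).
Proof.
  revert f; induction d as [|d IH]; intros f; simpl.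
  - intros [S E] Hl; apply (Csmooth_on_ext a b (fun x => RtoC (t x))).
    + intros; now rewrite E.
    + now apply Csmooth_on_RtoC.
  - intros (c & g & Sc & Pg & E) Hl.
    apply (Csmooth_on_ext a b (fun x => RtoC (c x) + / l * g l x)%C).
    + intros; rewrite E by auto; unfold Cdiv; now rewrite (Cmult_comm (g l x)).
    + apply Csmooth_on_plus; [now apply Csmooth_on_RtoC|].
      apply Csmooth_on_scal; now apply IH.
Qed.

Lemma Pol_plus (d : nat) (t t' : R -> R) (f f' : C -> R -> C) :
  pol d t f -> pol d t' f' ->
  pol d (fun x => t x + t' x) (fun l x => (f l x + f' l x)%C).
Proof.
  revert f f'; induction d as [|d IH]; intros f f'; simpl.
  - intros [S E] [S' E']; split; [now apply smooth_on_plus|].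
    intros; rewrite E, E', RtoC_plus; auto.
  - intros (c & g & Sc & Pg & E) (c' & g' & Sc' & Pg' & E').
    exists (fun x => c x + c' x), (fun l x => (g l x + g' l x)%C); repeat split.
    + now apply smooth_on_plus.
    + now apply IH.
    + intros; rewrite E, E', RtoC_plus by auto; unfold Cdiv; ring.
Qed.

Lemma Pol_scal (d : nat) (c t : R -> R) (f : C -> R -> C) :
  smooth_on I c -> pol d t f ->
  pol d (fun x => c x * t x) (fun l x => (RtoC (c x) * f l x)%C).
Proof.
  intros Hc; revert f; induction d as [|d IH]; intros f; simpl.
  - intros [S E]; split; [now apply smooth_on_mult|].
    intros; rewrite E, RtoC_mult; auto.
  - intros (c0 & g & Sc & Pg & E).
    exists (fun x => c x * c0 x), (fun l x => (RtoC (c x) * g l x)%C); repeat split.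
    + now apply smooth_on_mult.
    + now apply IH.
    + intros; rewrite E, RtoC_mult by auto; unfold Cdiv; ring.
Qed.

Lemma Pol_const (c : R -> R) : smooth_on I c -> pol 0 c (fun _ x => RtoC (c x)).
Proof. intros H; split; [exact H | reflexivity]. Qed.

Lemma Pol_div (d : nat) (t : R -> R) (f : C -> R -> C) :
  pol d t f -> pol (S d) t (fun l x => (f l x / l)%C).
Proof.
  intros H; exists (fun _ => 0), f; repeat split; auto.
  - apply smooth_on_const.
  - intros; now rewrite Cplus_0_l.
Qed.

Lemma Pol_zero (d : nat) : pol d (fun _ => 0) (fun _ _ => 0%C).
Proof.
  induction d as [|d IH].
  - apply (Pol_const (fun _ => 0)), smooth_on_const.
  - apply (Pol_ext (S d) (fun _ => 0) (fun _ => 0) (fun l _ => (0 / l)%C)); auto.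
    + intros; unfold Cdiv; now rewrite Cmult_0_l.
    + now apply (Pol_div d _ (fun _ _ => 0%C)).
Qed.

Lemma Pol_succ (d : nat) (t : R -> R) (f : C -> R -> C) :
  pol d t f -> pol (S d) (fun _ => 0) f.
Proof.
  revert f; induction d as [|d IH]; intros f.
  - intros [S E]; exists t, (fun _ _ => 0%C); repeat split; auto.
    + apply smooth_on_const.
    + intros; rewrite E by auto; unfold Cdiv; ring.
  - intros (c & g & Sc & Pg & E); exists c, g; auto.
Qed.

Lemma Pol_lt (d d' : nat) (t : R -> R) (f : C -> R -> C) :
  (d < d')%nat -> pol d t f -> pol d' (fun _ => 0) f.
Proof.
  intros H Hf; induction H as [|d' H IH]; [now apply (Pol_succ d t)|].
  now apply Pol_succ in IH.
Qed.

Lemma Pol_mult (d e : nat) (t t' : R -> R) (f f' : C -> R -> C) :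
  pol d t f -> pol e t' f' ->
  pol (d + e) (fun x => t x * t' x) (fun l x => (f l x * f' l x)%C).
Proof.
  revert f; induction d as [|d IH]; intros f; simpl.
  - intros [S E] H'.
    apply (Pol_ext e (fun x => t x * t' x) _ (fun l x => (RtoC (t x) * f' l x)%C)); auto.
    + intros; rewrite E; auto.
    + now apply Pol_scal.
  - intros (c & g & Sc & Pg & E) H'.
    apply (Pol_ext (S (d + e)) (fun x => 0 + t x * t' x) _
      (fun l x => (RtoC (c x) * f' l x + (g l x * f' l x) / l)%C)).
    + intros; ring.
    + intros; rewrite E by auto; unfold Cdiv; ring.
    + apply (Pol_plus (S (d + e)) (fun _ => 0)).
      * apply (Pol_lt e _ (fun x => c x * t' x)); [lia|]. now apply Pol_scal.
      * apply (Pol_div (d + e)); now apply IH.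
Qed.

Lemma Pol_deriv (n d : nat) (t : R -> R) (f : C -> R -> C) :
  pol d t f -> pol d (Derive_n t n) (fun l x => CDerive_n (f l) n x).
Proof.
  revert f; induction d as [|d IH]; intros f.
  - intros [S E]; split; [now apply smooth_on_Derive_n|].
    intros l x Hl Hx; rewrite <- CDerive_n_RtoC.
    apply (CDerive_n_ext a b); auto.
  - intros (c & g & Sc & Pg & E).
    exists (Derive_n c n), (fun l x => CDerive_n (g l) n x); repeat split.
    + now apply smooth_on_Derive_n.
    + now apply IH.
    + intros l x Hl Hx.
      rewrite (CDerive_n_ext a b _ (fun y => RtoC (c y) + / l * g l y)%C); auto.
      * assert (Csmooth_on I (g l)) by now apply (Pol_Csmooth d t).
        rewrite (CDerive_n_plus a b), (CDerive_n_scal a b), CDerive_n_RtoC; auto.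
        -- unfold Cdiv; now rewrite (Cmult_comm (/ l)).
        -- now apply Csmooth_on_RtoC.
        -- now apply Csmooth_on_scal.
      * intros; rewrite E by auto; unfold Cdiv; now rewrite (Cmult_comm (/ l)).
Qed.

Lemma Pol_sum (d n : nat) (t : nat -> R -> R) (f : nat -> C -> R -> C) :
  (forall k, (k <= n)%nat -> pol d (t k) (f k)) ->
  pol d (fun x => sum_n (fun k => t k x) n) (fun l x => sum_n (fun k => f k l x) n).
Proof.
  induction n as [|n IH]; intros H.
  - apply (Pol_ext d (t 0%nat) _ (f 0%nat)); [| |now apply H];
      intros; now rewrite sum_O.
  - apply (Pol_ext d (fun x => sum_n (fun k => t k x) n + t (S n) x) _
      (fun l x => (sum_n (fun k => f k l x) n + f (S n) l x)%C)).
    + intros; now rewrite sum_Sn.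
    + intros; now rewrite sum_Sn.
    + apply Pol_plus; auto.
Qed.

Lemma Pol_sum_zero (d n : nat) (f : nat -> C -> R -> C) :
  (forall k, (k <= n)%nat -> pol d (fun _ => 0) (f k)) ->
  pol d (fun _ => 0) (fun l x => sum_n (fun k => f k l x) n).
Proof.
  intros H; apply (Pol_ext d (fun x => sum_n (fun k => 0) n) _
     (fun l x => sum_n (fun k => f k l x) n)); auto.
  - intros; rewrite sum_n_const; ring.
  - now apply (Pol_sum d n (fun _ _ => 0)).
Qed.

(** Division with remainder in the variable 1/l by 1 - 4 rc/l. The leading coefficient -4 rc of the
    divisor gives the factor in the top coefficient of [h], and the remainder [c] will be the
    coefficient of the pole in [step_even]. *)
Lemma Pol_division (d : nat) (t : R -> R) (f : C -> R -> C) :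
  pol (S d) t f ->
  exists c h, smooth_on I c /\ pol d (fun x => - / (4 * rc) * t x) h /\
    forall l x, 4 * rc < Cmod l -> I x ->
      f l x = ((1 - RtoC (4 * rc) / l) * h l x + RtoC (c x))%C.
Proof.
  assert (H4 : RtoC (4 * rc) <> 0%C) by (intros E; apply RtoC_inj in E; lra).
  revert f; induction d as [|d IH]; intros f (c & g & Sc & Pg & E).
  - assert (St := Pol_smooth 0 t g Pg); destruct Pg as [_ Eg].
    exists (fun x => c x + / (4 * rc) * t x), (fun _ x => RtoC (- / (4 * rc) * t x)).
    split; [|split].
    + apply smooth_on_plus; auto; now apply smooth_on_scal.
    + apply (Pol_const (fun x => - / (4 * rc) * t x)); now apply smooth_on_scal.
    + intros l x Hl Hx; rewrite E, Eg by auto.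
      assert (Hl0 := outside_nonzero l Hl).
      rewrite RtoC_plus, !RtoC_mult, RtoC_opp, RtoC_inv, RtoC_mult by lra.
      rewrite RtoC_mult in H4.
      field; repeat split; auto; intros Z; apply H4; rewrite Z; ring.
  - destruct (IH g Pg) as (c' & h & Sc' & Ph & Eg).
    (* With D = 1 - 4 rc/l, the remainder [c'] of [g] contributes c'/l = (c'/(4 rc)) (1 - D) to
       [f]. *)
    exists (fun x => c x + / (4 * rc) * c' x),
           (fun l x => (RtoC (- / (4 * rc) * c' x) + h l x / l)%C).
    split; [|split].
    + apply smooth_on_plus; auto; now apply smooth_on_scal.
    + exists (fun x => - / (4 * rc) * c' x), h; repeat split; auto.
      now apply smooth_on_scal.
    + intros l x Hl Hx; rewrite E, Eg by auto.
      assert (Hl0 := outside_nonzero l Hl).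
      rewrite RtoC_plus, !RtoC_mult, RtoC_opp, RtoC_inv, RtoC_mult by lra.
      rewrite RtoC_mult in H4.
      field; repeat split; auto; intros Z; apply H4; rewrite Z; ring.
Qed.

End Pol.

(** * Degrees and leading coefficients of the string equation *)

Lemma RtoC_m1 : RtoC (-1) = (- RtoC 1)%C.
Proof. now rewrite <- RtoC_opp. Qed.

Lemma nat_parity (k : nat) : exists q, k = (2 * q)%nat \/ k = (2 * q + 1)%nat.
Proof. destruct (Nat.Even_or_Odd k) as [[q H]|[q H]]; exists q; auto. Qed.

Lemma pow_opp1_even (i : nat) : (-1) ^ (2 * i) = 1.
Proof. apply pow_1_even. Qed.

Lemma pow_opp1_odd (i : nat) : (-1) ^ (2 * i + 1) = -1.
Proof. rewrite Nat.add_1_r; apply pow_1_odd. Qed.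

Lemma sum_n_pairs {G : AbelianMonoid} (f : nat -> G) (K : nat) :
  sum_n f (2 * K + 1) = sum_n (fun i => plus (f (2 * i)%nat) (f (2 * i + 1)%nat)) K.
Proof.
  induction K as [|K IH].
  - change (2 * 0 + 1)%nat with 1%nat; now rewrite sum_Sn, !sum_O.
  - replace (2 * S K + 1)%nat with (S (S (2 * K + 1))) by lia.
    rewrite !sum_Sn, IH, <- plus_assoc.
    now replace (S (S (2 * K + 1))) with (2 * S K + 1)%nat by lia;
      replace (S (2 * K + 1)) with (2 * S K)%nat by lia.
Qed.

Lemma sum_n_even_odd {G : AbelianMonoid} (f : nat -> G) (K : nat) :
  sum_n f (2 * S K) = plus (sum_n (fun i => f (2 * i)%nat) (S K))
                           (sum_n (fun i => f (2 * i + 1)%nat) K).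
Proof.
  replace (2 * S K)%nat with (S (2 * K + 1)) at 1 by lia.
  rewrite sum_Sn, sum_n_pairs, sum_n_plus, (sum_Sn (fun i => f (2 * i)%nat)).
  replace (S (2 * K + 1)) with (2 * S K)%nat by lia.
  rewrite <- !plus_assoc; f_equal; apply plus_comm.
Qed.

Definition cconv (f g : nat -> C) (N : nat) : C :=
  sum_n (fun j => (f j * g (N - j)%nat)%C) N.

(** The coefficient of eps^j in F(eps; x) + F(-eps; x + c eps). The string equation has one such
    bracket for [c = -1] and one for [c = 1]. *)
Definition symm (c : R) (F : nat -> C -> R -> C) (j : nat) (l : C) (x : R) : C :=
  (F j l x + shift_coef F (-1) c j l x)%C.

Lemma lhs_coef_cconv (aa : nat -> R -> R) (F : nat -> C -> R -> C) N l x :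
  lhs_coef aa F N l x =
  cconv (fun i => RtoC (aa i x))
        (fun n => cconv (fun j => symm (-1) F j l x) (fun j => symm 1 F j l x) n) N.
Proof.
  apply sum_n_ext; intros i.
  etransitivity; [|apply (sum_n_mult_l (K := C_Ring))].
  apply sum_n_ext; intros j.
  unfold symm; symmetry; exact (Cmult_assoc _ _ _).
Qed.

(** The right-hand side of the string equation in the orders [N >= 1], where the constant -1 is
    absent. Being homogeneous in [F], it is compatible with dividing the resolvent by l/w_c. *)
Definition quad_coef (F : nat -> C -> R -> C) (N : nat) (l : C) (x : R) : C :=
  (l * cconv (fun i => F i l x) (fun i => F i l x) N)%C.

(** The terms of [shift_coef] of order at most [M]. The terms beyond them, at most three in the
    lemmas below, are the ones that can reach the top degree. *)
Definition shift_low (F : nat -> C -> R -> C) (s c : R) (M N : nat) (l : C) (x : R) : C :=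
  sum_n (fun k => (RtoC (s ^ k * c ^ (N - k) / INR (fact (N - k)))
                   * CDerive_n (fun y => F k l y) (N - k) x)%C) M.

Lemma shift_coef_S (F : nat -> C -> R -> C) (s c : R) (N : nat) (l : C) (x : R) :
  shift_coef F s c (S N) l x =
  (shift_low F s c N (S N) l x + RtoC (s ^ S N) * F (S N) l x)%C.
Proof.
  unfold shift_coef; rewrite sum_Sn, Nat.sub_diag, CDerive_n_0.
  unfold shift_low; simpl fact; simpl INR; simpl (c ^ 0).
  replace (s ^ S N * 1 / 1) with (s ^ S N) by field; reflexivity.
Qed.

Lemma shift_coef_SS (F : nat -> C -> R -> C) (s c : R) (N : nat) (l : C) (x : R) :
  shift_coef F s c (S (S N)) l x =
  (shift_low F s c N (S (S N)) l x
   + RtoC (s ^ S N * c) * CDerive_n (F (S N) l) 1 x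
   + RtoC (s ^ S (S N)) * F (S (S N)) l x)%C.
Proof.
  rewrite shift_coef_S; unfold shift_low; rewrite sum_Sn.
  replace (S (S N) - S N)%nat with 1%nat by lia.
  replace (s ^ S N * c ^ 1 / INR (fact 1)) with (s ^ S N * c) by (simpl; field).
  reflexivity.
Qed.

Lemma shift_coef_SSS (F : nat -> C -> R -> C) (s c : R) (N : nat) (l : C) (x : R) :
  shift_coef F s c (S (S (S N))) l x =
  (shift_low F s c N (S (S (S N))) l x
   + RtoC (s ^ S N * c ^ 2 / 2) * CDerive_n (F (S N) l) 2 x
   + RtoC (s ^ S (S N) * c) * CDerive_n (F (S (S N)) l) 1 x
   + RtoC (s ^ S (S (S N))) * F (S (S (S N))) l x)%C.
Proof.
  rewrite shift_coef_SS; unfold shift_low; rewrite sum_Sn.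
  replace (S (S (S N)) - S N)%nat with 2%nat by lia.
  replace (s ^ S N * c ^ 2 / INR (fact 2)) with (s ^ S N * c ^ 2 / 2)
    by (simpl; field).
  reflexivity.
Qed.

Section Leading.

Variables (a b : Rbar) (rc : R).
Hypothesis Hrc : 0 < rc.
Notation I := (Iopen a b).
Notation pol := (Pol a b rc).

Lemma Pol_shift_term (q : R) (n d : nat) (t : R -> R) (f : C -> R -> C) :
  pol d t f ->
  pol d (fun x => q * Derive_n t n x) (fun l x => (RtoC q * CDerive_n (f l) n x)%C).
Proof.
  intros H; apply (Pol_scal a b rc d (fun _ => q) (Derive_n t n)
    (fun l x => CDerive_n (f l) n x)).
  - apply smooth_on_const.
  - now apply Pol_deriv.
Qed.

Lemma Pol_cscal (q : R) (d : nat) (t : R -> R) (f : C -> R -> C) :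
  pol d t f -> pol d (fun x => q * t x) (fun l x => (RtoC q * f l x)%C).
Proof. apply (Pol_scal a b rc d (fun _ => q)), smooth_on_const. Qed.

Lemma Pol_minus (d : nat) (t t' : R -> R) (f f' : C -> R -> C) :
  pol d t f -> pol d t' f' ->
  pol d (fun x => t x - t' x) (fun l x => (f l x - f' l x)%C).
Proof.
  intros H H'.
  apply (Pol_ext a b rc d (fun x => t x + -1 * t' x) _
          (fun l x => (f l x + RtoC (-1) * f' l x)%C)).
  - intros; ring.
  - intros; rewrite RtoC_m1; ring.
  - apply Pol_plus; auto; now apply Pol_cscal.
Qed.

Definition rho (r : nat -> R -> R) (i : nat) : R -> R :=
  match i with O => fun _ => 0 | S i => r i end.

Section Symm.

Variables (F : nat -> C -> R -> C) (s r : nat -> R -> R) (N : nat).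
Hypothesis order_even : forall i, (2 * i <= N)%nat -> pol i (s i) (F (2 * i)%nat).
Hypothesis order_odd : forall i, (2 * i + 1 <= N)%nat -> pol (S i) (r i) (F (2 * i + 1)%nat).

Lemma Pol_low (k i : nat) :
  (k <= N)%nat -> (k <= 2 * i)%nat -> pol (S i) (fun _ => 0) (F k).
Proof.
  intros HN Hk; destruct (nat_parity k) as [q [->| ->]].
  - apply (Pol_lt a b rc q _ (s q)); [lia | apply order_even; lia].
  - apply (Pol_lt a b rc (S q) _ (r q)); [lia | apply order_odd; lia].
Qed.

Lemma Pol_shift_low (c : R) (M K i : nat) :
  (M <= N)%nat -> (M <= 2 * i)%nat ->
  pol (S i) (fun _ => 0) (shift_low F (-1) c M K).
Proof.
  intros HN HM; apply Pol_sum_zero; intros k Hk.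
  set (q := (-1) ^ k * c ^ (K - k) / INR (fact (K - k))).
  apply (Pol_ext a b rc (S i) (fun x => q * Derive_n (fun _ => 0) (K - k) x) _
    (fun l x => (RtoC q * CDerive_n (F k l) (K - k) x)%C)).
  - intros x _; destruct (K - k)%nat; [simpl; ring | rewrite Derive_n_const; ring].
  - reflexivity.
  - apply Pol_shift_term, Pol_low; lia.
Qed.

(** Degree [i] is reached only by F_{2i}, which enters twice because its reflection has sign +1, and
    by the first derivative of F_{2i-1}. *)
Lemma Pol_symm_even (c : R) (i : nat) :
  (2 * i <= N)%nat ->
  pol i (fun x => 2 * s i x - c * Derive_n (rho r i) 1 x) (symm c F (2 * i)).
Proof.
  intros Hi; destruct i as [|i].
  - apply (Pol_ext a b rc 0 (fun x => 2 * s 0%nat x) _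
      (fun l x => (RtoC 2 * F 0%nat l x)%C)).
    + intros; simpl; rewrite Derive_const; ring.
    + intros; unfold symm, shift_coef; simpl (2 * 0)%nat; rewrite sum_O; simpl Nat.sub.
      rewrite CDerive_n_0; simpl.
      replace (1 * 1 / 1) with 1 by field; replace 2 with (1 + 1) by ring.
      rewrite RtoC_plus; ring.
    + now apply Pol_cscal, (order_even 0).
  - apply (Pol_ext a b rc (S i)
      (fun x => s (S i) x + (0 + (-1) * c * Derive_n (r i) 1 x + 1 * s (S i) x)) _
      (fun l x => F (2 * S i)%nat l x + (shift_low F (-1) c (2 * i) (2 * S i) l x
         + RtoC ((-1) * c) * CDerive_n (F (2 * i + 1)%nat l) 1 x
         + RtoC 1 * F (2 * S i)%nat l x))%C).
    + intros; simpl rho; ring.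
    + intros; unfold symm.
      replace (2 * S i)%nat with (S (S (2 * i))) by lia.
      rewrite shift_coef_SS.
      replace (S (2 * i)) with (2 * i + 1)%nat by lia; rewrite pow_opp1_odd.
      replace (S (2 * i + 1)) with (2 * S i)%nat by lia; rewrite pow_opp1_even.
      reflexivity.
    + repeat apply Pol_plus.
      * apply (order_even (S i)); lia.
      * apply Pol_shift_low; lia.
      * apply (Pol_shift_term (-1 * c)), order_odd; lia.
      * apply (Pol_cscal 1), (order_even (S i)); lia.
Qed.

(** F_{2i+1}, of degree [i+1], cancels against its reflection. The degree drops to [i], reached by
    the first derivative of F_{2i} and the second derivative of F_{2i-1}. *)
Lemma Pol_symm_odd (c : R) (i : nat) :
  (2 * i + 1 <= N)%nat ->
  pol i (fun x => c * Derive_n (s i) 1 x - c ^ 2 / 2 * Derive_n (rho r i) 2 x)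
      (symm c F (2 * i + 1)).
Proof.
  intros Hi; destruct i as [|i].
  - apply (Pol_ext a b rc 0 (fun x => c * Derive_n (s 0%nat) 1 x) _
      (fun l x => (RtoC c * CDerive_n (F 0%nat l) 1 x)%C)).
    + intros; change (rho r 0) with (fun _ : R => 0); rewrite (Derive_n_const 1); ring.
    + intros; unfold symm; change (2 * 0 + 1)%nat with 1%nat; rewrite shift_coef_S.
      unfold shift_low; rewrite sum_O; simpl Nat.sub; simpl.
      replace (1 * (c * 1) / 1) with c by field; replace (-1 * 1) with (-1) by ring.
      rewrite RtoC_m1; change (fun y => F 0%nat l y) with (F 0%nat l); ring.
    + apply (Pol_shift_term c), (order_even 0); lia.
  - apply (Pol_ext a b rc (S i)
      (fun x => 0 + (-1) * c ^ 2 / 2 * Derive_n (r i) 2 x + 1 * c * Derive_n (s (S i)) 1 x) _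
      (fun l x => shift_low F (-1) c (2 * i) (2 * S i + 1) l x
         + RtoC ((-1) * c ^ 2 / 2) * CDerive_n (F (2 * i + 1)%nat l) 2 x
         + RtoC (1 * c) * CDerive_n (F (2 * S i)%nat l) 1 x)%C).
    + intros; simpl rho; field.
    + intros; unfold symm.
      replace (2 * S i + 1)%nat with (S (S (S (2 * i)))) by lia.
      rewrite shift_coef_SSS.
      replace (S (2 * i)) with (2 * i + 1)%nat by lia; rewrite pow_opp1_odd.
      replace (S (2 * i + 1)) with (2 * S i)%nat by lia; rewrite pow_opp1_even.
      replace (S (2 * S i)) with (2 * S i + 1)%nat by lia; rewrite pow_opp1_odd.
      rewrite RtoC_m1; ring.
    + repeat apply Pol_plus.
      * apply Pol_shift_low; lia.
      * apply (Pol_shift_term (-1 * c ^ 2 / 2)), order_odd; lia.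
      * apply (Pol_shift_term (1 * c)), (order_even (S i)); lia.
Qed.

End Symm.

Section Conv.

Variables (F G : nat -> C -> R -> C) (fe fo ge go : nat -> R -> R) (N : nat).
Hypothesis order_even : forall i, (2 * i <= N)%nat -> pol i (fe i) (F (2 * i)%nat).
Hypothesis order_odd : forall i, (2 * i + 1 <= N)%nat -> pol i (fo i) (F (2 * i + 1)%nat).
Hypothesis Ge : forall i, (2 * i <= N)%nat -> pol i (ge i) (G (2 * i)%nat).
Hypothesis Go : forall i, (2 * i + 1 <= N)%nat -> pol i (go i) (G (2 * i + 1)%nat).

Notation conv n := (fun l x => cconv (fun j => F j l x) (fun j => G j l x) n).

(** Here the orders [2i] and [2i+1] both have degree [i], as the brackets do. A product of two odd
    orders then loses one degree against a product of two even ones and leaves the top coefficient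
    alone. *)
Lemma Pol_conv_even (K : nat) :
  (2 * K <= N)%nat ->
  pol K (fun x => csum (fun j l => fe j x * ge l x) K) (conv (2 * K)%nat).
Proof.
  intros HK; unfold cconv, csum.
  assert (E : forall i, (i <= K)%nat -> pol K (fun x => fe i x * ge (K - i)%nat x)
     (fun l x => (F (2 * i)%nat l x * G (2 * K - 2 * i)%nat l x)%C)).
  { intros i Hi; replace (2 * K - 2 * i)%nat with (2 * (K - i))%nat by lia.
    replace K with (i + (K - i))%nat at 1 by lia.
    apply Pol_mult; [apply order_even | apply Ge]; lia. }
  destruct K as [|K].
  - apply (Pol_ext a b rc 0 (fun x => fe 0%nat x * ge 0%nat x) _
      (fun l x => (F 0%nat l x * G 0%nat l x)%C)).
    + intros; now rewrite sum_O.
    + intros; simpl; now rewrite sum_O.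
    + exact (E 0%nat (Nat.le_refl 0)).
  - eapply Pol_ext; [ | intros; symmetry; apply sum_n_even_odd |
      apply Pol_plus; [apply (Pol_sum a b rc (S K) (S K) _ _ E) |
        apply (Pol_sum_zero a b rc (S K) K (fun i l x =>
        (F (2 * i + 1)%nat l x * G (2 * S K - (2 * i + 1))%nat l x)%C))]].
    + intros; simpl; ring.
    + intros i Hi; replace (2 * S K - (2 * i + 1))%nat with (2 * (K - i) + 1)%nat by lia.
      apply (Pol_lt a b rc (i + (K - i)) _ (fun x => fo i x * go (K - i)%nat x)); [lia|].
      apply Pol_mult; [apply order_odd | apply Go]; lia.
Qed.

Lemma Pol_conv_odd (K : nat) :
  (2 * K + 1 <= N)%nat ->
  pol K (fun x => csum (fun j l => fe j x * go l x + fo j x * ge l x) K)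
      (conv (2 * K + 1)%nat).
Proof.
  intros HK; unfold cconv, csum.
  eapply Pol_ext; [reflexivity | intros; symmetry; apply sum_n_pairs |].
  apply (Pol_sum a b rc K K (fun i x => fe i x * go (K - i)%nat x + fo i x * ge (K - i)%nat x)
   (fun i l x => (F (2 * i)%nat l x * G (2 * K + 1 - 2 * i)%nat l x
     + F (2 * i + 1)%nat l x * G (2 * K + 1 - (2 * i + 1))%nat l x)%C)).
  intros i Hi.
  replace (2 * K + 1 - (2 * i + 1))%nat with (2 * (K - i))%nat by lia.
  replace (2 * K + 1 - 2 * i)%nat with (2 * (K - i) + 1)%nat by lia.
  replace K with (i + (K - i))%nat at 1 by lia.
  apply Pol_plus; apply Pol_mult; (apply order_even || apply order_odd || apply Ge || apply Go); lia.
Qed.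

Lemma Pol_conv_low (k K : nat) :
  (k <= N)%nat -> (k < 2 * K)%nat -> pol K (fun _ => 0) (conv k).
Proof.
  intros HN Hk; destruct (nat_parity k) as [q [->| ->]].
  - eapply Pol_lt, (Pol_conv_even q); lia.
  - eapply Pol_lt, (Pol_conv_odd q); lia.
Qed.

End Conv.

End Leading.

(** * Response of the string equation to changes in its highest orders *)

Lemma cconv_head (f g : nat -> C) (n : nat) :
  cconv f g (S n) = (f 0%nat * g (S n) + sum_n (fun i => f (S i) * g (n - i)%nat) n)%C.
Proof. exact (sum_n_head _ n). Qed.

Lemma cconv_ends (f g : nat -> C) (n : nat) :
  cconv f g (S (S n)) =
  (f 0%nat * g (S (S n)) + sum_n (fun j => f (S j) * g (S n - j)%nat) n
   + f (S (S n)) * g 0%nat)%C.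
Proof.
  unfold cconv; rewrite sum_Sn, sum_n_head, Nat.sub_diag; reflexivity.
Qed.

Lemma cconv_ext (f g f' g' : nat -> C) (n : nat) :
  (forall k, (k <= n)%nat -> f k = f' k) -> (forall k, (k <= n)%nat -> g k = g' k) ->
  cconv f g n = cconv f' g' n.
Proof.
  intros Hf Hg; apply sum_n_ext_loc; intros j Hj; rewrite Hf, Hg by lia; reflexivity.
Qed.

Lemma cconv_diff_last (f g f' g' : nat -> C) (n : nat) :
  (forall k, (k <= n)%nat -> f k = f' k) -> (forall k, (k <= n)%nat -> g k = g' k) ->
  (cconv f g (S n) - cconv f' g' (S n)
   = (f (S n) - f' (S n)) * g 0%nat + f 0%nat * (g (S n) - g' (S n)))%C.
Proof.
  intros Hf Hg; destruct n as [|n].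
  - unfold cconv; rewrite !sum_Sn, !sum_O; simpl.
    rewrite (Hf 0%nat), (Hg 0%nat) by lia.
    change (@plus C_AbelianMonoid) with Cplus; ring.
  - rewrite !cconv_ends.
    rewrite (sum_n_ext_loc (fun j => f (S j) * g (S n - j)%nat)%C
               (fun j => f' (S j) * g' (S n - j)%nat)%C)
      by (intros; rewrite Hf, Hg by lia; reflexivity).
    rewrite (Hf 0%nat), (Hg 0%nat) by lia; ring.
Qed.

Lemma cconv_diff_last_two (f g f' g' : nat -> C) (n : nat) :
  (forall k, (k <= S n)%nat -> f k = f' k) -> (forall k, (k <= S n)%nat -> g k = g' k) ->
  (cconv f g (S (S (S n))) - cconv f' g' (S (S (S n)))
   = (f (S (S (S n))) - f' (S (S (S n)))) * g 0%nat
     + (f (S (S n)) - f' (S (S n))) * g 1%nat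
     + f 1%nat * (g (S (S n)) - g' (S (S n)))
     + f 0%nat * (g (S (S (S n))) - g' (S (S (S n)))))%C.
Proof.
  intros Hf Hg; rewrite !cconv_ends.
  (* Without its two end terms the sum is again a convolution, of the shifted sequences, and these
     differ only in their last terms. *)
  assert (E : forall f g : nat -> C, sum_n (fun j => f (S j) * g (S (S n) - j)%nat)%C (S n)
    = cconv (fun j => f (S j)) (fun j => g (S j)) (S n)).
  { intros; apply sum_n_ext_loc; intros j Hj.
    now replace (S (S n) - j)%nat with (S (S n - j)) by lia. }
  rewrite !E.
  assert (D := cconv_diff_last (fun j => f (S j)) (fun j => g (S j))
    (fun j => f' (S j)) (fun j => g' (S j)) n).
  cbv beta in D.
  rewrite (Hf 0%nat), (Hg 0%nat) by lia.
  replace (f' 0%nat * g (S (S (S n))) +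
    cconv (fun j => f (S j)) (fun j => g (S j)) (S n) + f (S (S (S n))) * g' 0%nat -
    (f' 0%nat * g' (S (S (S n))) +
     cconv (fun j => f' (S j)) (fun j => g' (S j)) (S n) + f' (S (S (S n))) * g' 0%nat))%C
  with ((cconv (fun j => f (S j)) (fun j => g (S j)) (S n)
     - cconv (fun j => f' (S j)) (fun j => g' (S j)) (S n))
    + f' 0%nat * (g (S (S (S n))) - g' (S (S (S n))))
    + (f (S (S (S n))) - f' (S (S (S n)))) * g' 0%nat)%C by ring.
  rewrite D; [ring | intros; apply Hf; lia | intros; apply Hg; lia].
Qed.

Section Perturbation.

Variables (a b : Rbar) (l : C) (x : R).
Notation I := (Iopen a b).
Hypothesis Hx : I x.

Lemma shift_low_ext (F F' : nat -> C -> R -> C) (s c : R) (M N : nat) :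
  (forall k y, (k <= M)%nat -> I y -> F k l y = F' k l y) ->
  shift_low F s c M N l x = shift_low F' s c M N l x.
Proof.
  intros H; apply sum_n_ext_loc; intros k Hk; apply f_equal2; [reflexivity|].
  apply (CDerive_n_ext a b); auto.
Qed.

Lemma symm_ext (F F' : nat -> C -> R -> C) (c : R) (j : nat) :
  (forall k y, (k <= j)%nat -> I y -> F k l y = F' k l y) ->
  symm c F j l x = symm c F' j l x.
Proof.
  intros H; unfold symm; rewrite (H j) by auto; f_equal.
  exact (shift_low_ext F F' (-1) c j j H).
Qed.

Lemma symm_0 (F : nat -> C -> R -> C) (c : R) : symm c F 0 l x = (2 * F 0%nat l x)%C.
Proof.
  unfold symm, shift_coef; rewrite sum_O; simpl Nat.sub; rewrite CDerive_n_0; simpl.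
  replace (1 * 1 / 1) with 1 by field; ring.
Qed.

(** F_1 cancels against its reflection, and the remaining derivative of F_0 is that of a
    constant. *)
Lemma symm_1 (F : nat -> C -> R -> C) (c : R) :
  (forall y, I y -> F 0%nat l y = 1%C) -> symm c F 1 l x = 0%C.
Proof.
  intros H; unfold symm; rewrite shift_coef_S.
  unfold shift_low; rewrite sum_O; simpl Nat.sub.
  rewrite (CDerive_n_ext a b _ (fun _ => RtoC 1)), (CDerive_n_RtoC (fun _ => 1)),
    Derive_n_const by auto.
  simpl; replace (-1 * 1) with (-1) by ring; rewrite RtoC_m1; ring.
Qed.

Lemma symm_diff_last (F F' : nat -> C -> R -> C) (c : R) (n : nat) :
  (forall k y, (k <= n)%nat -> I y -> F k l y = F' k l y) ->
  (symm c F (S n) l x - symm c F' (S n) l x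
   = RtoC (1 + (-1) ^ S n) * (F (S n) l x - F' (S n) l x))%C.
Proof.
  intros H; unfold symm; rewrite !shift_coef_S, (shift_low_ext F F') by auto.
  rewrite RtoC_plus; ring.
Qed.

(** The derivative of the change in order [S n] enters with the factor [c], so it cancels between
    [c = -1] and [c = 1]. Hence no derivative of the pole coefficient will appear. *)
Lemma symm_diff_last_two (F F' : nat -> C -> R -> C) (n : nat) :
  (forall k y, (k <= n)%nat -> I y -> F k l y = F' k l y) ->
  ((symm (-1) F (S (S n)) l x - symm (-1) F' (S (S n)) l x)
   + (symm 1 F (S (S n)) l x - symm 1 F' (S (S n)) l x)
   = RtoC (2 * (1 + (-1) ^ S (S n))) * (F (S (S n)) l x - F' (S (S n)) l x))%C.
Proof.
  intros H; unfold symm; rewrite !shift_coef_SS, !(shift_low_ext F F') by auto.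
  rewrite !RtoC_mult, RtoC_plus, RtoC_m1; ring.
Qed.

Variables (F F' : nat -> C -> R -> C) (aa : nat -> R -> R).
Hypothesis HF0 : forall y, I y -> F 0%nat l y = 1%C.

(** Each bracket changes by 1 + (-1)^(n+1) times the change of F and is multiplied by the order 0 of
    the other bracket, which is 2. The result is 0 in odd orders and 8 [aa 0] times the change in
    even ones. *)
Lemma lhs_coef_diff_last (n : nat) :
  (forall k y, (k <= n)%nat -> I y -> F k l y = F' k l y) ->
  (lhs_coef aa F (S n) l x - lhs_coef aa F' (S n) l x
   = RtoC (4 * aa 0%nat x * (1 + (-1) ^ S n)) * (F (S n) l x - F' (S n) l x))%C.
Proof.
  intros H; rewrite !lhs_coef_cconv.
  rewrite cconv_diff_last; [ | reflexivity | ].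
  - rewrite cconv_diff_last, !symm_diff_last, !symm_0 by
      (auto; intros; apply symm_ext; intros; apply H; auto; lia).
    rewrite HF0 by auto.
    rewrite !RtoC_mult; ring.
  - intros k Hk; apply cconv_ext; intros; apply symm_ext; intros; apply H; auto; lia.
Qed.

(** The terms with [aa 0] drop out: the top order is odd, the derivatives cancel by
    [symm_diff_last_two], and the brackets vanish in order 1. What remains is [aa 1] times the
    change of an even order, with the factor 8 of [lhs_coef_diff_last]. *)
Lemma lhs_coef_diff_last_two (n : nat) :
  (forall k y, (k <= S n)%nat -> I y -> F k l y = F' k l y) ->
  (-1) ^ S (S n) = 1 ->
  (lhs_coef aa F (S (S (S n))) l x - lhs_coef aa F' (S (S (S n))) l x
   = RtoC (8 * aa 1%nat x) * (F (S (S n)) l x - F' (S (S n)) l x))%C.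
Proof.
  intros H Hn; rewrite !lhs_coef_cconv.
  assert (SE : forall c k, (k <= S n)%nat -> symm c F k l x = symm c F' k l x)
    by (intros; apply symm_ext; intros; apply H; auto; lia).
  assert (HF0' : forall y, I y -> F' 0%nat l y = 1%C)
    by (intros; rewrite <- H; auto; lia).
  rewrite cconv_diff_last_two; [ | reflexivity | ].
  - rewrite (cconv_diff_last _ _ _ _ (S n)), !symm_diff_last, !symm_0 by auto.
    rewrite cconv_diff_last_two, !symm_0, !symm_1 by auto.
    rewrite HF0 by auto.
    assert (E := symm_diff_last_two F F' (S n) H).
    replace ((-1) ^ S (S (S n))) with (-1) in E by (rewrite <- tech_pow_Rmult, Hn; ring).
    rewrite Hn.
    set (A3 := symm (-1) F (S (S (S n))) l x) in *.
    set (A3' := symm (-1) F' (S (S (S n))) l x) in *.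
    set (B3 := symm 1 F (S (S (S n))) l x) in *.
    set (B3' := symm 1 F' (S (S (S n))) l x) in *.
    set (d := (F (S (S n)) l x - F' (S (S n)) l x)%C).
    set (al := RtoC (aa 0%nat x)).
    transitivity (RtoC (aa 1%nat x) * (RtoC (1 + 1) * d * (2 * 1) + 2 * 1 * (RtoC (1 + 1) * d))
      + al * (2 * ((A3 - A3') + (B3 - B3'))))%C; [ring|].
    rewrite E; replace (2 * (1 + -1)) with 0 by ring.
    replace (8 * aa 1%nat x) with (aa 1%nat x * (1 + 1) * 2 * 2) by ring.
    rewrite !RtoC_mult; ring.
  - intros k Hk; apply cconv_ext; intros; apply SE; lia.
Qed.

Lemma quad_coef_diff_last (n : nat) :
  (forall k y, (k <= n)%nat -> I y -> F k l y = F' k l y) ->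
  (quad_coef F (S n) l x - quad_coef F' (S n) l x
   = 2 * (l * F (S n) l x - l * F' (S n) l x))%C.
Proof.
  intros H; unfold quad_coef.
  transitivity (l * (cconv (fun i => F i l x) (fun i => F i l x) (S n)
    - cconv (fun i => F' i l x) (fun i => F' i l x) (S n)))%C; [ring|].
  rewrite cconv_diff_last, HF0 by auto; ring.
Qed.

Lemma quad_coef_diff_last_two (n : nat) :
  (forall k y, (k <= S n)%nat -> I y -> F k l y = F' k l y) ->
  (quad_coef F (S (S (S n))) l x - quad_coef F' (S (S (S n))) l x
   = 2 * (l * F (S (S (S n))) l x - l * F' (S (S (S n))) l x)
     + 2 * (l * F 1%nat l x) * (F (S (S n)) l x - F' (S (S n)) l x))%C.
Proof.
  intros H; unfold quad_coef.
  transitivity (l * (cconv (fun i => F i l x) (fun i => F i l x) (S (S (S n)))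
    - cconv (fun i => F' i l x) (fun i => F' i l x) (S (S (S n)))))%C; [ring|].
  rewrite cconv_diff_last_two, HF0 by auto; ring.
Qed.

End Perturbation.

(** * Determination of the resolvent order by order *)

Section Recursion.

Variables (a b : Rbar) (rc : R) (aa : nat -> R -> R) (s r : nat -> R -> R).
Hypothesis Hrc : 0 < rc.
Notation I := (Iopen a b).
Notation pol := (Pol a b rc).
Notation dom l := (4 * rc < Cmod l).
Hypothesis Haa0 : forall x, aa 0%nat x = rc.
Hypothesis Haa : forall k, (1 <= k)%nat -> smooth_on I (aa k).
Hypothesis Hs0 : forall x, s 0%nat x = 1.
Hypothesis Hr0 : forall x, r 0%nat x = 2 * aa 1%nat x.
Hypothesis Hs : forall k, smooth_on I (s k).
Hypothesis Hr : forall k, smooth_on I (r k).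

Notation D1 f := (Derive_n f 1).
Notation D2 f := (Derive_n f 2).

Hypothesis Hquad : forall k x, I x ->
  csum (fun j l => 4 * rc * s j x * s l x
                   - rc * D1 (rho r j) x * D1 (rho r l) x) (S k)
  = csum (fun i l => r i x * r l x) k.
Hypothesis Hlin : forall K x, I x ->
  csum (fun j l => aa 1%nat x * (4 * s j x * s l x - D1 (rho r j) x * D1 (rho r l) x)
                   + rc * (2 * D1 (s j) x * D1 (rho r l) x
                           - 2 * D2 (rho r j) x * s l x)) K
  = csum (fun j l => 2 * r j x * s l x) K.

Lemma aa_smooth (k : nat) : smooth_on I (aa k).
Proof.
  destruct k as [|k]; [|apply Haa; lia].
  apply (smooth_on_ext a b (fun _ => rc)); [now intros; rewrite Haa0 | apply smooth_on_const].
Qed.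

Section Residual.

Variables (F : nat -> C -> R -> C) (N : nat).
Hypothesis F0 : forall l x, dom l -> I x -> F 0%nat l x = 1%C.
Hypothesis Ge : forall i, (2 * S i <= N)%nat ->
  pol i (s (S i)) (fun l x => (l * F (2 * S i)%nat l x)%C).
Hypothesis Go : forall i, (2 * i + 1 <= N)%nat ->
  pol i (r i) (fun l x => (l * F (2 * i + 1)%nat l x)%C).

Lemma order_even (i : nat) : (2 * i <= N)%nat -> pol i (s i) (F (2 * i)%nat).
Proof.
  intros Hi; destruct i as [|i].
  - split; auto; intros; rewrite F0, Hs0; auto.
  - eapply Pol_ext; [reflexivity | | apply Pol_div, Ge, Hi].
    intros l x Hl Hx; cbv beta; field; now apply (outside_nonzero rc).
Qed.

Lemma order_odd (i : nat) : (2 * i + 1 <= N)%nat -> pol (S i) (r i) (F (2 * i + 1)%nat).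
Proof.
  intros Hi; eapply Pol_ext; [reflexivity | | apply Pol_div, Go, Hi].
  intros l x Hl Hx; cbv beta; field; now apply (outside_nonzero rc).
Qed.

Notation SE c := (fun i => Pol_symm_even a b rc F s r N order_even order_odd c i).
Notation SO c := (fun i => Pol_symm_odd a b rc F s r N order_even order_odd c i).
Notation AB n := (fun l x => cconv (fun j => symm (-1) F j l x) (fun j => symm 1 F j l x) n).

(** An index in [aa] uses up order without contributing degree. In even orders only [aa 0] reaches
    the top degree; in odd orders, where the bound on the degree is lower, [aa 0] and [aa 1] do. *)
Lemma Pol_lhs_even (K : nat) :
  (2 * S K <= N)%nat ->
  pol (S K) (fun x => csum (fun j l => 4 * rc * s j x * s l x
                   - rc * D1 (rho r j) x * D1 (rho r l) x) (S K))
      (lhs_coef aa F (2 * S K)).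
Proof.
  intros HK.
  eapply (Pol_ext a b rc (S K) _ _ (fun l x => RtoC (aa 0%nat x) * AB (2 * S K)%nat l x
     + sum_n (fun i => RtoC (aa (S i) x) * AB (2 * K + 1 - i)%nat l x) (2 * K + 1))%C);
    [ | | apply Pol_plus; [apply Pol_scal, (Pol_conv_even a b rc _ _ _ _ _ _ N
        (SE (-1)) (SO (-1)) (SE 1) (SO 1)) |
        apply (Pol_sum_zero a b rc (S K) (2 * K + 1) (fun i l x => RtoC (aa (S i) x) * AB (2 * K + 1 - i)%nat l x)%C)]].
  - intros x Hx; cbv beta; rewrite Haa0, Rplus_0_r, <- csum_scal.
    apply csum_sym; intros; ring.
  - intros l x Hl Hx; rewrite lhs_coef_cconv.
    replace (2 * S K)%nat with (S (2 * K + 1)) by lia.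
    now rewrite (cconv_head (fun i => RtoC (aa i x))).
  - apply aa_smooth.
  - exact HK.
  - intros i Hi; eapply Pol_ext; [ | reflexivity |
      apply Pol_scal; [apply aa_smooth |
        apply (Pol_conv_low a b rc _ _ _ _ _ _ N
        (SE (-1)) (SO (-1)) (SE 1) (SO 1) (2 * K + 1 - i) (S K)); lia]].
    intros; apply Rmult_0_r.
Qed.

Lemma Pol_lhs_odd (K : nat) :
  (2 * K + 1 <= N)%nat ->
  pol K (fun x =>  csum (fun j l => aa 1%nat x * (4 * s j x * s l x - D1 (rho r j) x * D1 (rho r l) x)
                   + rc * (2 * D1 (s j) x * D1 (rho r l) x
                           - 2 * D2 (rho r j) x * s l x)) K)
      (lhs_coef aa F (2 * K + 1)).
Proof.
  intros HK.
  assert (P0 := Pol_conv_odd a b rc _ _ _ _ _ _ N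
        (SE (-1)) (SO (-1)) (SE 1) (SO 1) K HK).
  assert (P1 := Pol_conv_even a b rc _ _ _ _ _ _ N
        (SE (-1)) (SO (-1)) (SE 1) (SO 1) K ltac:(lia)).
  apply (Pol_scal a b rc _ (aa 0%nat) _ _ (aa_smooth 0)) in P0.
  apply (Pol_scal a b rc _ (aa 1%nat) _ _ (aa_smooth 1)) in P1.
  (* The terms with [aa k] for [k >= 2]. Since [sum_n] always has at least one term, the empty range
     at [K = 0] is a separate case. *)
  assert (PT : pol K (fun _ => 0) (fun l x => match K with O => 0%C | S K =>
     sum_n (fun i => RtoC (aa (S (S i)) x) * AB (2 * K + 1 - i)%nat l x)%C (2 * K + 1) end)).
  { destruct K as [|K]; [apply (Pol_zero a b rc 0)|].
    apply (Pol_sum_zero a b rc (S K) (2 * K + 1)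
      (fun i l x => RtoC (aa (S (S i)) x) * AB (2 * K + 1 - i)%nat l x)%C).
    intros i Hi; eapply Pol_ext; [ | reflexivity |
      apply Pol_scal; [apply aa_smooth |
        apply (Pol_conv_low a b rc _ _ _ _ _ _ N
        (SE (-1)) (SO (-1)) (SE 1) (SO 1) (2 * K + 1 - i) (S K)); lia]].
    intros; apply Rmult_0_r. }
  eapply Pol_ext; [ | | exact (Pol_plus _ _ _ _ _ _ _ _ (Pol_plus _ _ _ _ _ _ _ _ P0 P1) PT)].
  - intros x Hx; cbv beta; rewrite Haa0, Rplus_0_r, <- !csum_scal, <- csum_plus.
    apply csum_sym; intros; field.
  - intros l x Hl Hx; rewrite lhs_coef_cconv; cbv beta.
    rewrite Nat.add_1_r, (cconv_head (fun i => RtoC (aa i x))).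
    rewrite <- Cplus_assoc; apply f_equal2; [reflexivity|].
    destruct K as [|K].
    + rewrite sum_O; simpl; now rewrite Cplus_0_r.
    + replace (2 * S K)%nat with (S (2 * K + 1)) by lia.
      now rewrite sum_n_head.
Qed.

(** The factor [l] is absorbed into one of the two factors and lowers its degree by one. Two odd
    orders then reach degree [K+1], two even ones only [K]: the reverse of the situation on the
    left-hand side. *)
Lemma Pol_quad_even (K : nat) :
  (2 * S K <= N)%nat ->
  pol (S K) (fun x => csum (fun i l => r i x * r l x) K) (quad_coef F (2 * S K)).
Proof.
  intros HK.
  eapply (Pol_ext a b rc (S K) _ _ (fun l x =>
     sum_n (fun i => (l * F (2 * i)%nat l x) * F (2 * S K - 2 * i)%nat l x) (S K)
     + sum_n (fun i => (l * F (2 * i + 1)%nat l x) * F (2 * S K - (2 * i + 1))%nat l x) K)%C);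
    [ | | apply Pol_plus; [
       apply (Pol_sum_zero a b rc (S K) (S K)
         (fun i l x => (l * F (2 * i)%nat l x) * F (2 * S K - 2 * i)%nat l x)%C) |
       apply (Pol_sum a b rc (S K) K (fun i x => r i x * r (K - i)%nat x)
         (fun i l x => (l * F (2 * i + 1)%nat l x) * F (2 * S K - (2 * i + 1))%nat l x)%C)]].
  - intros; apply Rplus_0_l.
  - intros l x Hl Hx; unfold quad_coef, cconv; rewrite sum_n_even_odd.
    etransitivity; [|symmetry; apply Cmult_plus_distr_l].
    apply f_equal2; (etransitivity; [|apply (sum_n_mult_l (K := C_Ring))]);
    apply sum_n_ext; intros; symmetry; exact (Cmult_assoc _ _ _).
  (* For [i = 0] the first factor is F_0 = 1 and cannot absorb [l]; the other factor takes it. *)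
  - intros i Hi; destruct i as [|i].
    + apply (Pol_lt a b rc K _ (s (S K))); [lia|].
      eapply Pol_ext; [reflexivity | | exact (Ge K HK)].
      intros l x Hl Hx; cbv beta; rewrite Nat.mul_0_r, Nat.sub_0_r, F0 by auto; ring.
    + apply (Pol_lt a b rc (i + (K - i)) _ (fun x => s (S i) x * s (K - i)%nat x)); [lia|].
      replace (2 * S K - 2 * S i)%nat with (2 * (K - i))%nat by lia.
      apply (Pol_mult a b rc i (K - i) _ _ (fun l x => l * F (2 * S i)%nat l x)%C).
      * apply Ge; lia.
      * apply order_even; lia.
  - intros i Hi.
    replace (2 * S K - (2 * i + 1))%nat with (2 * (K - i) + 1)%nat by lia.
    replace (S K) with (i + S (K - i))%nat by lia.
    apply (Pol_mult a b rc i (S (K - i)) _ _ (fun l x => l * F (2 * i + 1)%nat l x)%C).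
    + apply Go; lia.
    + apply order_odd; lia.
Qed.

Lemma Pol_quad_odd (K : nat) :
  (2 * K + 1 <= N)%nat ->
  pol K (fun x => csum (fun j l => 2 * r j x * s l x) K) (quad_coef F (2 * K + 1)).
Proof.
  intros HK.
  eapply (Pol_ext a b rc K _ _ (fun l x =>
     sum_n (fun i => F (2 * i)%nat l x * (l * F (2 * K + 1 - 2 * i)%nat l x)
       + (l * F (2 * i + 1)%nat l x) * F (2 * K + 1 - (2 * i + 1))%nat l x) K)%C);
    [ | |
       apply (Pol_sum a b rc K K (fun i x => s i x * r (K - i)%nat x + r i x * s (K - i)%nat x)
         (fun i l x => F (2 * i)%nat l x * (l * F (2 * K + 1 - 2 * i)%nat l x)
       + (l * F (2 * i + 1)%nat l x) * F (2 * K + 1 - (2 * i + 1))%nat l x)%C)].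
  - intros x Hx.
    change (csum (fun j l => s j x * r l x + r j x * s l x) K
      = csum (fun j l => 2 * r j x * s l x) K).
    apply csum_sym; intros; ring.
  - intros l x Hl Hx; unfold quad_coef, cconv; rewrite sum_n_pairs.
    etransitivity; [|apply (sum_n_mult_l (K := C_Ring))].
    apply sum_n_ext; intros.
    change (@mult C_Ring) with Cmult; change (@plus C_AbelianMonoid) with Cplus.
    ring_in C.
  - intros i Hi.
    replace (2 * K + 1 - (2 * i + 1))%nat with (2 * (K - i))%nat by lia.
    replace (2 * K + 1 - 2 * i)%nat with (2 * (K - i) + 1)%nat by lia.
    replace K with (i + (K - i))%nat at 1 by lia.
    apply Pol_plus.
    + apply (Pol_mult a b rc i (K - i) _ _ (F (2 * i)%nat)
        (fun l x => l * F (2 * (K - i) + 1)%nat l x)%C); [apply order_even | apply Go]; lia.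
    + apply (Pol_mult a b rc i (K - i) _ _ (fun l x => l * F (2 * i + 1)%nat l x)%C);
       [apply Go | apply order_even]; lia.
Qed.

(** The defect of a trial sequence in the string equation. [Hquad] and [Hlin] state that its top
    coefficient vanishes when all orders have the predicted leading terms. *)
Definition residual (G : nat -> C -> R -> C) (n : nat) (l : C) (x : R) : C :=
  (quad_coef G n l x - lhs_coef aa G n l x)%C.

Lemma Pol_residual_even (K : nat) :
  (2 * S K <= N)%nat -> pol (S K) (fun _ => 0) (residual F (2 * S K)).
Proof.
  intros HK; eapply Pol_ext; [ | reflexivity |
    apply (Pol_minus a b rc); [now apply Pol_quad_even | now apply Pol_lhs_even]].
  intros x Hx; cbv beta; rewrite Hquad by auto; ring.
Qed.

Lemma Pol_residual_odd (K : nat) :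
  (2 * K + 1 <= N)%nat -> pol K (fun _ => 0) (residual F (2 * K + 1)).
Proof.
  intros HK; eapply Pol_ext; [ | reflexivity |
    apply (Pol_minus a b rc); [now apply Pol_quad_odd | now apply Pol_lhs_odd]].
  intros x Hx; cbv beta; rewrite Hlin by auto; ring.
Qed.

End Residual.

Definition monomial (d : nat) (t : R -> R) (l : C) (x : R) : C := (RtoC (t x) / l ^ d)%C.

Lemma Pol_monomial (d : nat) (t : R -> R) :
  smooth_on I t -> pol d t (monomial d t).
Proof.
  intros St; induction d as [|d IH].
  - apply (Pol_ext a b rc 0 t t (fun _ x => RtoC (t x))); auto.
    + intros; unfold monomial; simpl; field.
    + now apply Pol_const.
  - eapply Pol_ext; [reflexivity | | apply Pol_div, IH].
    intros l x Hl Hx; unfold monomial; simpl; field.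
    assert (l <> 0%C) by now apply (outside_nonzero rc).
    split; auto; now apply Cpow_nz.
Qed.

Lemma l_monomial (d : nat) (t : R -> R) (l : C) (x : R) :
  dom l -> (l * monomial (S d) t l x)%C = monomial d t l x.
Proof.
  intros Hl; assert (l <> 0%C) by now apply (outside_nonzero rc).
  unfold monomial; simpl; field; split; auto; now apply Cpow_nz.
Qed.

Definition update (F : nat -> C -> R -> C) (N : nat) (f : C -> R -> C) (k : nat) :=
  if Nat.eqb k N then f else F k.

Lemma update_eq F N f : update F N f N = f.
Proof. unfold update; now rewrite Nat.eqb_refl. Qed.

Lemma update_neq F N f k : k <> N -> update F N f k = F k.
Proof. intros H; unfold update; now destruct (Nat.eqb_spec k N). Qed.

Lemma dom_factor_nonzero (l : C) : dom l -> (1 - RtoC (4 * rc) / l)%C <> 0%C.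
Proof.
  intros Hl E; assert (l <> 0%C) by now apply (outside_nonzero rc).
  assert (l = RtoC (4 * rc)).
  { transitivity (l * (1 - RtoC (4 * rc) / l) + RtoC (4 * rc))%C; [field; auto|].
    rewrite E; ring. }
  subst l; rewrite Cmod_R, Rabs_right in Hl by lra; lra.
Qed.

Section Step.

Variables (F : nat -> C -> R -> C).
Hypothesis F0 : forall l x, dom l -> I x -> F 0%nat l x = 1%C.
Hypothesis Heq : forall N l x, (1 <= N)%nat -> dom l -> I x ->
  lhs_coef aa F N l x = quad_coef F N l x.

(** Replacing F_{2K+1} by the monomial with the predicted coefficient leaves the left-hand side
    unchanged and changes the right-hand side by 2 l times the difference. So l F_{2K+1} is r_K/l^K
    minus half the defect of the trial sequence, whose top coefficient is zero. *)
Lemma step_odd (K : nat) :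
  (forall i, (2 * S i < 2 * K + 1)%nat ->
     pol i (s (S i)) (fun l x => (l * F (2 * S i)%nat l x)%C)) ->
  (forall i, (2 * i + 1 < 2 * K + 1)%nat ->
     pol i (r i) (fun l x => (l * F (2 * i + 1)%nat l x)%C)) ->
  pol K (r K) (fun l x => (l * F (2 * K + 1)%nat l x)%C).
Proof.
  intros He Ho.
  set (F' := update F (2 * K + 1) (monomial (S K) (r K))).
  assert (HF' : forall k, (k <= 2 * K)%nat -> F' k = F k)
    by (intros; apply update_neq; lia).
  assert (P : pol K (fun _ => 0) (residual F' (2 * K + 1))).
  { apply Pol_residual_odd with (N := (2 * K + 1)%nat); auto.
    - intros; rewrite HF' by lia; auto.
    - intros i Hi; rewrite HF' by lia; apply He; lia.
    - intros i Hi; destruct (Nat.eq_dec i K) as [->|].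
      + unfold F'; rewrite update_eq.
        eapply Pol_ext; [reflexivity | intros; symmetry; now apply l_monomial |].
        now apply Pol_monomial.
      + rewrite HF' by lia; apply Ho; lia. }
  eapply Pol_ext; [ | | apply Pol_plus;
    [apply (Pol_monomial K (r K)); auto | apply (Pol_cscal a b rc (- / 2)), P]].
  - intros; cbv beta; ring.
  - intros l x Hl Hx; cbv beta; unfold residual.
    assert (HE : forall k y, (k <= 2 * K)%nat -> I y -> F k l y = F' k l y)
      by (intros; now rewrite HF').
    assert (Q := quad_coef_diff_last a b l x Hx F F' (fun y Hy => F0 l y Hl Hy) _ HE).
    assert (L := lhs_coef_diff_last a b l x Hx F F' aa (fun y Hy => F0 l y Hl Hy) _ HE).
    rewrite pow_1_odd in L; replace (S (2 * K)) with (2 * K + 1)%nat in * by lia.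
    replace (4 * aa 0%nat x * (1 + -1)) with 0 in L by ring.
    rewrite (Heq (2 * K + 1) l x) in L by (auto; lia).
    unfold F' at 2 in Q; rewrite update_eq, l_monomial in Q by auto.
    set (q := quad_coef F (2 * K + 1) l x) in *.
    set (q' := quad_coef F' (2 * K + 1) l x) in *.
    replace (lhs_coef aa F' (2 * K + 1) l x) with q.
    2: { transitivity (q - lhs_coef aa F' (2 * K + 1) l x + lhs_coef aa F' (2 * K + 1) l x)%C;
         [ring | rewrite L; ring]. }
    replace q' with (q - 2 * (l * F (2 * K + 1)%nat l x - monomial K (r K) l x))%C
      by (rewrite <- Q; ring).
    rewrite RtoC_opp, RtoC_inv by lra.
    field; intros Z; apply RtoC_inj in Z; lra.
Qed.

(** Here the left-hand side changes as well, by 8 rc times the difference of F and the monomial.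
    Hence (1 - 4 rc/l) times the deviation of l F_{2(K+1)} from its predicted leading term is minus
    half the defect, and [Pol_division] leaves a constant over 1 - 4 rc/l. *)
Lemma step_even (K : nat) :
  (forall i, (2 * S i < 2 * S K)%nat ->
     pol i (s (S i)) (fun l x => (l * F (2 * S i)%nat l x)%C)) ->
  (forall i, (2 * i + 1 < 2 * S K)%nat ->
     pol i (r i) (fun l x => (l * F (2 * i + 1)%nat l x)%C)) ->
  exists c h, smooth_on I c /\ pol K (s (S K)) h /\
    forall l x, dom l -> I x ->
    (l * F (2 * S K)%nat l x = h l x + RtoC (c x) / (1 - RtoC (4 * rc) / l))%C.
Proof.
  intros He Ho.
  set (F' := update F (2 * S K) (monomial (S K) (s (S K)))).
  assert (HF' : forall k, (k <= 2 * K + 1)%nat -> F' k = F k)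
    by (intros; apply update_neq; lia).
  assert (P : pol (S K) (fun _ => 0) (residual F' (2 * S K))).
  { apply Pol_residual_even with (N := (2 * S K)%nat); auto.
    - intros i Hi; destruct (Nat.eq_dec i K) as [->|].
      + unfold F'; rewrite update_eq.
        eapply Pol_ext; [reflexivity | intros; symmetry; now apply l_monomial |].
        now apply Pol_monomial.
      + rewrite HF' by lia; apply He; lia.
    - intros i Hi; rewrite HF' by lia; apply Ho; lia. }
  apply (Pol_cscal a b rc (- / 2)) in P.
  destruct (Pol_division a b rc Hrc _ _ _ P) as (c & h & Sc & Ph & E).
  exists c, (fun l x => monomial K (s (S K)) l x + h l x)%C; split; [auto|split].
  - eapply Pol_ext; [ | reflexivity | apply Pol_plus;
     [apply (Pol_monomial K (s (S K))); auto | exact Ph]].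
    intros; cbv beta; ring.
  - intros l x Hl Hx; specialize (E l x Hl Hx); cbv beta in E; unfold residual in E.
    assert (HE : forall k y, (k <= 2 * K + 1)%nat -> I y -> F k l y = F' k l y)
      by (intros; now rewrite HF').
    assert (Q := quad_coef_diff_last a b l x Hx F F' (fun y Hy => F0 l y Hl Hy) _ HE).
    assert (L := lhs_coef_diff_last a b l x Hx F F' aa (fun y Hy => F0 l y Hl Hy) _ HE).
    replace (S (2 * K + 1)) with (2 * S K)%nat in * by lia.
    rewrite pow_1_even, Haa0 in L.
    rewrite (Heq (2 * S K) l x) in L by (auto; lia).
    unfold F' at 2 in Q; rewrite update_eq, l_monomial in Q by auto.
    assert (Hl0 := outside_nonzero rc Hrc l Hl).
    assert (HD := dom_factor_nonzero l Hl).
    assert (H2 : RtoC 2 <> 0%C) by (intros Z; apply RtoC_inj in Z; lra).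
    set (q := quad_coef F (2 * S K) l x) in *.
    set (q' := quad_coef F' (2 * S K) l x) in *.
    set (p' := lhs_coef aa F' (2 * S K) l x) in *.
    set (f := F (2 * S K)%nat l x) in *.
    assert (EF' : F' (2 * S K)%nat l x = (monomial K (s (S K)) l x / l)%C).
    { unfold F'; rewrite update_eq, <- (l_monomial K) by auto; field; auto. }
    rewrite EF' in L.
    set (g := monomial K (s (S K)) l x) in *.
    assert (R : ((1 - RtoC (4 * rc) / l) * (l * f - g) = RtoC (- / 2) * (q' - p'))%C).
    { replace q' with (q - 2 * (l * f - g))%C by (rewrite <- Q; ring).
      replace p' with (q - RtoC (4 * rc * (1 + 1)) * (f - g / l))%C by (rewrite <- L; ring).
      rewrite RtoC_opp, RtoC_inv, !RtoC_mult, RtoC_plus by lra.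
      replace (1 + 1)%C with (RtoC 2) by (now rewrite <- RtoC_plus).
      field; auto. }
    rewrite E in R.
    transitivity (g + ((1 - RtoC (4 * rc) / l) * (l * f - g)) / (1 - RtoC (4 * rc) / l))%C;
      [set (D := (1 - RtoC (4 * rc) / l)%C) in *; field; auto |].
    rewrite R; set (D := (1 - RtoC (4 * rc) / l)%C) in *; field; auto.
Qed.

(** Effect of a surviving pole on the next order. The trial sequence drops the pole term d = c/(l (1
    - 4 rc/l)) from F_{2(K+1)}. That changes the left-hand side by 8 u d and the right-hand side by
    2 (l F_1) d = 4 u d, and half the difference is the term 2 u d in l F_{2(K+1)+1}. *)
Lemma step_last (K : nat) (c : R -> R) (h : C -> R -> C) :
  (forall i, (2 * S i < 2 * S K)%nat ->
     pol i (s (S i)) (fun l x => (l * F (2 * S i)%nat l x)%C)) ->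
  (forall i, (2 * i + 1 < 2 * S K)%nat ->
     pol i (r i) (fun l x => (l * F (2 * i + 1)%nat l x)%C)) ->
  pol K (s (S K)) h ->
  (forall l x, dom l -> I x ->
    (l * F (2 * S K)%nat l x = h l x + RtoC (c x) / (1 - RtoC (4 * rc) / l))%C) ->
  exists e, pol (S K) (r (S K)) e /\
    forall l x, dom l -> I x ->
    (l * F (2 * S K + 1)%nat l x
     = e l x + RtoC (2 * aa 1%nat x * c x) / (l * (1 - RtoC (4 * rc) / l)))%C.
Proof.
  intros He Ho Ph Eh.
  set (F1 := update F (2 * S K) (fun l x => h l x / l)%C).
  set (F' := update F1 (2 * S K + 1) (monomial (S (S K)) (r (S K)))).
  assert (HF' : forall k, (k <= 2 * K + 1)%nat -> F' k = F k).
  { intros; unfold F'; rewrite update_neq by lia; apply update_neq; lia. }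
  assert (HF1 : F' (2 * S K)%nat = (fun l x => h l x / l)%C).
  { unfold F'; rewrite update_neq by lia; apply update_eq. }
  assert (HF2 : F' (2 * S K + 1)%nat = monomial (S (S K)) (r (S K))) by apply update_eq.
  assert (P : pol (S K) (fun _ => 0) (residual F' (2 * S K + 1))).
  { apply Pol_residual_odd with (N := (2 * S K + 1)%nat); auto.
    - intros i Hi; destruct (Nat.eq_dec i K) as [->|].
      + rewrite HF1; eapply Pol_ext; [reflexivity | | exact Ph].
        intros l x Hl Hx; cbv beta; field; now apply (outside_nonzero rc).
      + rewrite HF' by lia; apply He; lia.
    - intros i Hi; destruct (Nat.eq_dec i (S K)) as [->|].
      + rewrite HF2; eapply Pol_ext; [reflexivity | intros; symmetry; now apply l_monomial |].
        now apply Pol_monomial.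
      + rewrite HF' by lia; apply Ho; lia. }
  exists (fun l x => monomial (S K) (r (S K)) l x + RtoC (- / 2) * residual F' (2 * S K + 1) l x)%C.
  split.
  { eapply Pol_ext; [ | reflexivity | apply Pol_plus;
      [apply (Pol_monomial (S K) (r (S K))); auto | apply (Pol_cscal a b rc (- / 2)), P]].
    intros; cbv beta; ring. }
  intros l x Hl Hx; unfold residual.
  assert (Hl0 := outside_nonzero rc Hrc l Hl).
  assert (HD := dom_factor_nonzero l Hl).
  assert (H2 : RtoC 2 <> 0%C) by (intros Z; apply RtoC_inj in Z; lra).
  assert (HE : forall k y, (k <= S (2 * K))%nat -> I y -> F k l y = F' k l y)
      by (intros; rewrite HF'; auto; lia).
  assert (Q := quad_coef_diff_last_two a b l x Hx F F' (fun y Hy => F0 l y Hl Hy) _ HE).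
  assert (L := lhs_coef_diff_last_two a b l x Hx F F' aa (fun y Hy => F0 l y Hl Hy) _ HE).
  replace (S (S (2 * K))) with (2 * S K)%nat in * by lia.
  replace (S (2 * S K)) with (2 * S K + 1)%nat in * by lia.
  specialize (L (pow_1_even _)).
  rewrite (Heq (2 * S K + 1) l x) in L by (auto; lia).
  rewrite HF2, l_monomial, HF1 in Q by auto; rewrite HF1 in L.
  (* In degree 0 the known shape is an equation: l F_1 = r_0 = 2 [aa 1]. *)
  destruct (Ho 0%nat ltac:(lia)) as [_ E0]; specialize (E0 l x Hl Hx).
  change (2 * 0 + 1)%nat with 1%nat in E0; rewrite E0, Hr0 in Q.
  assert (Ed : (F (2 * S K)%nat l x - h l x / l = RtoC (c x) / (l * (1 - RtoC (4 * rc) / l)))%C).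
  { transitivity ((l * F (2 * S K)%nat l x) / l - h l x / l)%C; [field; auto|].
    rewrite Eh by auto; set (D := (1 - RtoC (4 * rc) / l)%C) in *; field; auto. }
  rewrite Ed in Q, L.
  set (q := quad_coef F (2 * S K + 1) l x) in *.
  set (q' := quad_coef F' (2 * S K + 1) l x) in *.
  set (p' := lhs_coef aa F' (2 * S K + 1) l x) in *.
  set (f := F (2 * S K + 1)%nat l x) in *.
  set (g := monomial (S K) (r (S K)) l x) in *.
  set (D := (1 - RtoC (4 * rc) / l)%C) in *.
  replace q' with (q - (q - q'))%C by ring; rewrite Q.
  replace p' with (q - (q - p'))%C by ring; rewrite L.
  rewrite RtoC_opp, RtoC_inv, !RtoC_mult by lra.
  replace 8 with (2 * 2 * 2) by ring; rewrite !RtoC_mult.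
  field; auto.
Qed.

(* The poles at [l = 4 rc] in the orders below [2m] are removed one at a time
   by the string equation, which enters through [Hkill]. *)
Lemma structure_below (m : nat) :
  (forall K c h, (S K < m)%nat -> smooth_on I c -> pol K (s (S K)) h ->
     (forall l x, dom l -> I x ->
       (l * F (2 * S K)%nat l x = h l x + RtoC (c x) / (1 - RtoC (4 * rc) / l))%C) ->
     forall x, I x -> c x = 0) ->
  (forall i, (S i < m)%nat -> pol i (s (S i)) (fun l x => (l * F (2 * S i)%nat l x)%C)) /\
  (forall i, (i < m)%nat -> pol i (r i) (fun l x => (l * F (2 * i + 1)%nat l x)%C)).
Proof.
  intros Hkill.
  enough (H : forall n, (n <= m)%nat ->
    (forall i, (S i < n)%nat -> pol i (s (S i)) (fun l x => (l * F (2 * S i)%nat l x)%C)) /\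
    (forall i, (i < n)%nat -> pol i (r i) (fun l x => (l * F (2 * i + 1)%nat l x)%C)))
    by now apply H.
  induction n as [|n IH]; intros Hn; [split; intros; lia|].
  destruct (IH ltac:(lia)) as [He Ho].
  (* Order [2n] is settled before order [2n+1], since [step_odd] needs it free of the pole. *)
  assert (He' : forall i, (S i < S n)%nat ->
     pol i (s (S i)) (fun l x => (l * F (2 * S i)%nat l x)%C)).
  { intros i Hi; destruct (Nat.eq_dec (S i) n) as [E|]; [|apply He; lia].
    destruct (step_even i) as (c & h & Sc & Ph & Eh).
    - intros; apply He; lia.
    - intros; apply Ho; lia.
    - eapply Pol_ext; [reflexivity | | exact Ph].
      intros l x Hl Hx; rewrite Eh by auto.
      rewrite (Hkill i c h ltac:(lia) Sc Ph Eh x Hx).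
      assert (HD := dom_factor_nonzero l Hl).
      set (D := (1 - RtoC (4 * rc) / l)%C) in *; field; auto. }
  split; [exact He'|].
  intros i Hi; destruct (Nat.eq_dec i n) as [->|]; [|apply Ho; lia].
  apply step_odd; intros; [apply He' | apply Ho]; lia.
Qed.

End Step.

End Recursion.

(** * Contour integrals *)

(** Stated in components because [RInt_C] reduces the contour integral to two real integrals. *)
Definition continuous_C (f : R -> C) : Prop :=
  (forall t, continuous (fun t => Re (f t)) t) /\ (forall t, continuous (fun t => Im (f t)) t).

Lemma continuous_C_const (c : C) : continuous_C (fun _ => c).
Proof. split; intros t; apply continuous_const. Qed.

Lemma continuous_C_ext (f g : R -> C) :
  (forall t, f t = g t) -> continuous_C f -> continuous_C g.
Proof.
  intros H [F1 F2]; split; intros t.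
  - apply (continuous_ext (fun t => Re (f t))); [intros; now rewrite H | apply F1].
  - apply (continuous_ext (fun t => Im (f t))); [intros; now rewrite H | apply F2].
Qed.

Lemma continuous_C_plus (f g : R -> C) :
  continuous_C f -> continuous_C g -> continuous_C (fun t => (f t + g t)%C).
Proof.
  intros [F1 F2] [G1 G2]; split; intros t.
  - exact (continuous_plus _ _ t (F1 t) (G1 t)).
  - exact (continuous_plus _ _ t (F2 t) (G2 t)).
Qed.

Lemma continuous_C_mult (f g : R -> C) :
  continuous_C f -> continuous_C g -> continuous_C (fun t => (f t * g t)%C).
Proof.
  intros [F1 F2] [G1 G2]; split; intros t.
  - exact (continuous_minus _ _ t (continuous_mult _ _ t (F1 t) (G1 t))
             (continuous_mult _ _ t (F2 t) (G2 t))).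
  - exact (continuous_plus _ _ t (continuous_mult _ _ t (F1 t) (G2 t))
             (continuous_mult _ _ t (F2 t) (G1 t))).
Qed.

Lemma norm2_pos (z : C) : z <> 0%C -> 0 < Re z ^ 2 + Im z ^ 2.
Proof.
  intros H; rewrite <- Cmod2_alt; apply pow_lt, Cmod_gt_0, H.
Qed.

Lemma continuous_norm2 (f : R -> C) (t : R) :
  continuous_C f -> continuous (fun t => Re (f t) ^ 2 + Im (f t) ^ 2) t.
Proof.
  intros [F1 F2]; apply (continuous_ext (fun t => Re (f t) * Re (f t) + Im (f t) * Im (f t))).
  - intros y; ring_in R.
  - exact (continuous_plus _ _ t (continuous_mult _ _ t (F1 t) (F1 t))
             (continuous_mult _ _ t (F2 t) (F2 t))).
Qed.

Lemma continuous_C_inv (f : R -> C) :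
  continuous_C f -> (forall t, f t <> 0%C) -> continuous_C (fun t => (/ f t)%C).
Proof.
  intros H Hf; assert (H' := H); destruct H' as [F1 F2].
  assert (J : forall t, continuous (fun t => / (Re (f t) ^ 2 + Im (f t) ^ 2)) t).
  { intros t; apply continuous_Rinv_comp; [now apply continuous_norm2|].
    apply Rgt_not_eq, norm2_pos, Hf. }
  split; intros t.
  - exact (continuous_mult _ _ t (F1 t) (J t)).
  - apply (continuous_mult (fun t => - Im (f t)) _ t); [|exact (J t)].
    exact (continuous_opp _ t (F2 t)).
Qed.

Lemma continuous_C_div (f g : R -> C) :
  continuous_C f -> continuous_C g -> (forall t, g t <> 0%C) ->
  continuous_C (fun t => (f t / g t)%C).
Proof.
  intros Hf Hg Hn; apply continuous_C_mult; [assumption | now apply continuous_C_inv].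
Qed.

Lemma continuous_C_pow (f : R -> C) (n : nat) :
  continuous_C f -> continuous_C (fun t => (f t ^ n)%C).
Proof.
  intros H; induction n as [|n IH]; simpl.
  - apply continuous_C_const.
  - now apply continuous_C_mult.
Qed.

Lemma continuous_C_sum (f : nat -> R -> C) (n : nat) :
  (forall k, continuous_C (f k)) -> continuous_C (fun t => sum_n (fun k => f k t) n).
Proof.
  intros H; induction n as [|n IH].
  - apply (continuous_C_ext (f 0%nat)); [intros; now rewrite sum_O | auto].
  - apply (continuous_C_ext (fun t => sum_n (fun k => f k t) n + f (S n) t)%C).
    + intros; now rewrite sum_Sn.
    + now apply continuous_C_plus.
Qed.

Lemma Cmod_plus_Re_pos (z : C) : 0 < Re z -> 0 < (Cmod z + Re z) / 2.
Proof. intros H; assert (h := Cmod_ge_0 z); lra. Qed.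

(* On the right half plane the two branches in [Csqrt] agree with a formula
   without case distinction. *)
Lemma Csqrt_right (z : C) :
  0 < Re z ->
  Csqrt z = (sqrt ((Cmod z + Re z) / 2), Im z / (2 * sqrt ((Cmod z + Re z) / 2))).
Proof.
  intros H; unfold Csqrt; f_equal.
  assert (Hp := Cmod_plus_Re_pos z H).
  set (p := sqrt ((Cmod z + Re z) / 2)).
  assert (Pp : 0 < p) by now apply sqrt_lt_R0.
  assert (Ep : p * p = (Cmod z + Re z) / 2) by (apply sqrt_sqrt; lra).
  assert (M := Cmod2_alt z).
  assert (E : (Cmod z - Re z) / 2 = Rsqr (Im z / (2 * p))).
  { unfold Rsqr; field_simplify; [|lra].
    replace (4 * p ^ 2) with (2 * (Cmod z + Re z)) by (simpl; lra).
    replace (Im z ^ 2) with ((Cmod z - Re z) * (Cmod z + Re z)) by (simpl in *; lra).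
    field; lra. }
  rewrite E, sqrt_Rsqr_abs.
  assert (Hi : 0 < / (2 * p)) by (apply Rinv_0_lt_compat; lra).
  destruct (Rlt_dec (Im z) 0) as [Hl|Hl].
  - rewrite Rabs_left; [ring|]. unfold Rdiv; nra.
  - rewrite Rabs_right; [reflexivity|]. unfold Rdiv; nra.
Qed.

Lemma Csqrt_sqr (z : C) : 0 < Re z -> (Csqrt z * Csqrt z)%C = z.
Proof.
  intros H; rewrite Csqrt_right by assumption.
  assert (Hp := Cmod_plus_Re_pos z H).
  set (p := sqrt ((Cmod z + Re z) / 2)).
  assert (Pp : 0 < p) by now apply sqrt_lt_R0.
  assert (Ep : p * p = (Cmod z + Re z) / 2) by (apply sqrt_sqrt; lra).
  assert (M := Cmod2_alt z).
  apply injective_projections; simpl; fold (Re z); fold (Im z).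
  - replace (Im z / (2 * p) * (Im z / (2 * p))) with (Im z ^ 2 / (4 * (p * p))) by (field; lra).
    rewrite Ep.
    replace (Im z ^ 2) with ((Cmod z - Re z) * (Cmod z + Re z)) by (simpl in *; lra).
    field; lra.
  - field; lra.
Qed.

Lemma continuous_C_sqrt (f : R -> C) :
  continuous_C f -> (forall t, 0 < Re (f t)) -> continuous_C (fun t => Csqrt (f t)).
Proof.
  intros H Hf; assert (H' := H); destruct H' as [F1 F2].
  set (p := fun t => sqrt ((Cmod (f t) + Re (f t)) / 2)).
  assert (P : forall t, continuous p t).
  { intros t; apply continuous_sqrt_comp.
    apply (continuous_mult _ (fun _ => / 2) t); [|apply continuous_const].
    apply (continuous_plus (fun t => Cmod (f t)) _ t); [|apply F1].
    apply continuous_sqrt_comp; now apply continuous_norm2. }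
  assert (Hp : forall t, 0 < p t) by (intros t; apply sqrt_lt_R0, Cmod_plus_Re_pos, Hf).
  apply (continuous_C_ext (fun t => (p t, Im (f t) / (2 * p t)))).
  { intros t; symmetry; now apply Csqrt_right. }
  split; intros t; simpl.
  - apply P.
  - apply (continuous_mult _ (fun t => / (2 * p t)) t); [apply F2|].
    apply continuous_Rinv_comp.
    + apply (continuous_mult (fun _ => 2) _ t); [apply continuous_const | apply P].
    + specialize (Hp t); lra.
Qed.

(** Since |4 rc/l| < 1, the argument of [Csqrt] in [wc] stays off the branch cut. Both the square
    identity and the continuity of [wc] rest on this. *)
Lemma Re_wc_arg (rc : R) (l : C) : 0 < rc -> 4 * rc < Cmod l -> 0 < Re (1 - RtoC (4 * rc) / l)%C.
Proof.
  intros Hrc Hl.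
  assert (Hl0 : l <> 0%C) by now apply (outside_nonzero rc).
  assert (M : Cmod (RtoC (4 * rc) / l)%C < 1).
  { rewrite Cmod_div, Cmod_R, Rabs_right by (assumption || lra).
    apply (Rmult_lt_reg_r (Cmod l)); [lra|]. field_simplify; lra. }
  assert (h := re_le_Cmod (RtoC (4 * rc) / l)%C).
  assert (h2 := Rle_abs (Re (RtoC (4 * rc) / l)%C)).
  change (0 < 1 + - Re (RtoC (4 * rc) / l)%C); lra.
Qed.

Lemma wc_sqr (rc : R) (l : C) :
  0 < rc -> 4 * rc < Cmod l -> (wc rc l * wc rc l)%C = (l * (l - RtoC (4 * rc)))%C.
Proof.
  intros Hrc Hl; unfold wc.
  transitivity (l * l * (Csqrt (1 - RtoC (4 * rc) / l) * Csqrt (1 - RtoC (4 * rc) / l)))%C; [ring|].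
  rewrite Csqrt_sqr by now apply Re_wc_arg.
  field; now apply (outside_nonzero rc).
Qed.

Lemma outside_minus_nonzero (rc : R) (l : C) :
  0 < rc -> 4 * rc < Cmod l -> (l - RtoC (4 * rc))%C <> 0%C.
Proof.
  intros Hrc Hl E; apply (dom_factor_nonzero rc Hrc l Hl).
  assert (Hl0 : l <> 0%C) by now apply (outside_nonzero rc).
  transitivity ((l - RtoC (4 * rc)) / l)%C; [field; auto | rewrite E; unfold Cdiv; ring].
Qed.

Lemma wc_nonzero (rc : R) (l : C) : 0 < rc -> 4 * rc < Cmod l -> wc rc l <> 0%C.
Proof.
  intros Hrc Hl E; assert (W := wc_sqr rc l Hrc Hl); rewrite E, Cmult_0_l in W.
  symmetry in W; revert W; apply Cmult_neq_0.
  - now apply (outside_nonzero rc).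
  - now apply outside_minus_nonzero.
Qed.

Definition circle (Rad t : R) : C := (Rad * cos t, Rad * sin t).

Lemma Cmod_circle (Rad t : R) : 0 <= Rad -> Cmod (circle Rad t) = Rad.
Proof.
  intros H; unfold Cmod, circle; simpl.
  replace (Rad * cos t * (Rad * cos t * 1) + Rad * sin t * (Rad * sin t * 1))
    with (Rsqr Rad * (Rsqr (sin t) + Rsqr (cos t))) by (unfold Rsqr; ring).
  rewrite sin2_cos2, Rmult_1_r; now apply sqrt_Rsqr.
Qed.

Lemma continuous_circle (Rad : R) : continuous_C (circle Rad).
Proof.
  split; intros t; simpl.
  - apply (continuous_mult (fun _ => Rad) cos t); [apply continuous_const | apply continuous_cos].
  - apply (continuous_mult (fun _ => Rad) sin t); [apply continuous_const | apply continuous_sin].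
Qed.

Lemma ex_RInt_continuous_R (f : R -> R) (u v : R) :
  (forall t, continuous f t) -> ex_RInt f u v.
Proof. intros H; apply (ex_RInt_continuous (V := R_CompleteNormedModule)); auto. Qed.

Lemma RInt_C (f : R -> C) (u v : R) :
  continuous_C f ->
  @RInt C_R_CompleteNormedModule f u v
  = (RInt (fun t => Re (f t)) u v, RInt (fun t => Im (f t)) u v).
Proof.
  intros [F1 F2].
  apply (is_RInt_unique (V := C_R_CompleteNormedModule)).
  apply (is_RInt_fct_extend_pair (U := R_NormedModule) (V := R_NormedModule) f).
  - apply (RInt_correct (V := R_CompleteNormedModule)), ex_RInt_continuous_R, F1.
  - apply (RInt_correct (V := R_CompleteNormedModule)), ex_RInt_continuous_R, F2.
Qed.

Section Contour.

Variable Rad : R.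

Definition circle_cont (f : C -> C) : Prop := continuous_C (fun t => f (circle Rad t)).

Lemma oint_RInt (f : C -> C) :
  circle_cont f ->
  let g := fun t => (f (circle Rad t) * circle Rad t)%C in
  oint Rad f = (RtoC (/ (2 * PI)) *
     (RInt (fun t => Re (g t)) 0 (2 * PI), RInt (fun t => Im (g t)) 0 (2 * PI)))%C.
Proof.
  intros H g; rewrite <- RInt_C; [reflexivity|].
  apply continuous_C_mult; [exact H | apply continuous_circle].
Qed.

Lemma oint_ext (f g : C -> C) :
  0 <= Rad -> (forall l, Cmod l = Rad -> f l = g l) -> oint Rad f = oint Rad g.
Proof.
  intros HR H; unfold oint; f_equal.
  apply (RInt_ext (V := C_R_CompleteNormedModule)); intros t _; cbv zeta.
  rewrite H; [reflexivity | now apply (Cmod_circle Rad t)].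
Qed.

Lemma circle_cont_ext (f g : C -> C) :
  0 <= Rad -> (forall l, Cmod l = Rad -> f l = g l) -> circle_cont f -> circle_cont g.
Proof.
  intros HR H; apply continuous_C_ext; intros t; apply H; now apply Cmod_circle.
Qed.

Lemma circle_cont_plus (f g : C -> C) :
  circle_cont f -> circle_cont g -> circle_cont (fun l => (f l + g l)%C).
Proof. apply continuous_C_plus. Qed.

Lemma circle_cont_mult (f g : C -> C) :
  circle_cont f -> circle_cont g -> circle_cont (fun l => (f l * g l)%C).
Proof. apply continuous_C_mult. Qed.

Lemma circle_cont_div (f g : C -> C) :
  0 <= Rad -> circle_cont f -> circle_cont g -> (forall l, Cmod l = Rad -> g l <> 0%C) ->
  circle_cont (fun l => (f l / g l)%C).
Proof.
  intros HR Hf Hg Hn; apply continuous_C_div; auto.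
  intros t; apply Hn; now apply Cmod_circle.
Qed.

Lemma circle_cont_id : circle_cont (fun l => l).
Proof. apply continuous_circle. Qed.

Lemma circle_cont_const (c : C) : circle_cont (fun _ => c).
Proof. apply continuous_C_const. Qed.

Lemma oint_plus (f g : C -> C) :
  circle_cont f -> circle_cont g ->
  oint Rad (fun l => (f l + g l)%C) = (oint Rad f + oint Rad g)%C.
Proof.
  intros Hf Hg.
  rewrite (oint_RInt _ (circle_cont_plus f g Hf Hg)), (oint_RInt f Hf), (oint_RInt g Hg); cbv zeta.
  destruct (continuous_C_mult _ _ Hf (continuous_circle Rad)) as [F1 F2].
  destruct (continuous_C_mult _ _ Hg (continuous_circle Rad)) as [G1 G2].
  rewrite <- Cmult_plus_distr_l; f_equal; unfold Cplus at 3; simpl fst; simpl snd; f_equal.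
  - etransitivity; [|apply (RInt_plus (V := R_CompleteNormedModule)); now apply ex_RInt_continuous_R].
    apply (RInt_ext (V := R_CompleteNormedModule)); intros t _; simpl; unfold plus; simpl; ring.
  - etransitivity; [|apply (RInt_plus (V := R_CompleteNormedModule)); now apply ex_RInt_continuous_R].
    apply (RInt_ext (V := R_CompleteNormedModule)); intros t _; simpl; unfold plus; simpl; ring.
Qed.

(** The integral is taken in [C] as a real normed module, so a complex factor is moved out in
    components. *)
Lemma oint_scal (c : C) (f : C -> C) :
  circle_cont f -> oint Rad (fun l => (c * f l)%C) = (c * oint Rad f)%C.
Proof.
  intros Hf; destruct c as [c1 c2].
  rewrite (oint_RInt _ (circle_cont_mult _ f (circle_cont_const (c1, c2)) Hf)), (oint_RInt f Hf);
    cbv zeta.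
  set (g := fun t => (f (circle Rad t) * circle Rad t)%C).
  destruct (continuous_C_mult _ _ Hf (continuous_circle Rad)) as [F1 F2].
  fold g in F1, F2.
  assert (X1 := ex_RInt_continuous_R _ 0 (2 * PI) F1).
  assert (X2 := ex_RInt_continuous_R _ 0 (2 * PI) F2).
  match goal with |- _ = (?u * (?k * ?v))%C => transitivity (k * (u * v))%C; [|ring] end.
  apply (f_equal (Cmult _)), injective_projections; cbn [fst snd Cmult].
  - transitivity (RInt (fun t => minus (scal c1 (Re (g t))) (scal c2 (Im (g t)))) 0 (2 * PI)).
    + apply (RInt_ext (V := R_CompleteNormedModule)); intros t _; unfold g, minus, plus, opp, scal;
        simpl; unfold mult; simpl; ring.
    + rewrite (RInt_minus (V := R_CompleteNormedModule)), !(RInt_scal (V := R_CompleteNormedModule));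
        auto; now apply (ex_RInt_scal (V := R_NormedModule)).
  - transitivity (RInt (fun t => plus (scal c1 (Im (g t))) (scal c2 (Re (g t)))) 0 (2 * PI)).
    + apply (RInt_ext (V := R_CompleteNormedModule)); intros t _; unfold g, plus, scal;
        simpl; unfold mult; simpl; ring.
    + rewrite (RInt_plus (V := R_CompleteNormedModule)), !(RInt_scal (V := R_CompleteNormedModule));
        auto; now apply (ex_RInt_scal (V := R_NormedModule)).
Qed.

End Contour.

(** * Moments of the potential *)

Section Moments.

Variables (p : nat) (g2 : nat -> R) (rc Rad : R).
Hypothesis Hrc : 0 < rc.
Hypothesis HRad : 4 * rc < Rad.

(** As VV_k = (l/w_c) F_k, this is the functional that the second string equation applies to F_k. *)
Definition pairing (f : C -> C) : C :=
  oint Rad (fun l => Vlam p g2 l * (l / wc rc l * f l))%C.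

Definition moment (k : nat) : C := pairing (fun l => / l ^ k)%C.

Lemma circle_outside (l : C) : Cmod l = Rad -> 4 * rc < Cmod l.
Proof. intros ->; exact HRad. Qed.

Lemma circle_cont_Vlam : circle_cont Rad (Vlam p g2).
Proof.
  apply (continuous_C_sum (fun j t => RtoC (INR (S j) * g2 (S j)) * circle Rad t ^ j)%C).
  intros k; apply continuous_C_mult; [apply continuous_C_const|].
  apply continuous_C_pow, continuous_circle.
Qed.

Lemma circle_cont_wc : circle_cont Rad (wc rc).
Proof.
  apply circle_cont_mult; [apply circle_cont_id|].
  apply continuous_C_sqrt.
  - apply continuous_C_plus; [apply continuous_C_const|].
    apply (continuous_C_ext (fun t => RtoC (-1) * (RtoC (4 * rc) / circle Rad t))%C).
    { intros t; rewrite RtoC_m1; ring. }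
    apply continuous_C_mult; [apply continuous_C_const|].
    apply continuous_C_div; [apply continuous_C_const | apply continuous_circle |].
    intros t; apply (outside_nonzero rc); auto; rewrite Cmod_circle; lra.
  - intros t; apply Re_wc_arg; auto; rewrite Cmod_circle; lra.
Qed.

Lemma circle_cont_weight (f : C -> C) :
  circle_cont Rad f -> circle_cont Rad (fun l => Vlam p g2 l * (l / wc rc l * f l))%C.
Proof.
  intros Hf; apply circle_cont_mult; [apply circle_cont_Vlam|].
  apply circle_cont_mult; [|assumption].
  apply circle_cont_div; [lra | apply circle_cont_id | apply circle_cont_wc |].
  intros l Hl; apply wc_nonzero; auto; now apply circle_outside.
Qed.

Lemma pairing_ext (f g : C -> C) :
  (forall l, Cmod l = Rad -> f l = g l) -> pairing f = pairing g.
Proof.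
  intros H; unfold pairing; apply oint_ext; [lra|].
  intros l Hl; rewrite (H l Hl); reflexivity.
Qed.

Lemma pairing_plus (f g : C -> C) :
  circle_cont Rad f -> circle_cont Rad g ->
  pairing (fun l => f l + g l)%C = (pairing f + pairing g)%C.
Proof.
  intros Hf Hg; unfold pairing.
  rewrite <- (oint_plus Rad _ _ (circle_cont_weight f Hf) (circle_cont_weight g Hg)).
  apply oint_ext; [lra|]; intros; ring.
Qed.

Lemma pairing_scal (c : C) (f : C -> C) :
  circle_cont Rad f -> pairing (fun l => c * f l)%C = (c * pairing f)%C.
Proof.
  intros Hf; unfold pairing.
  rewrite <- (oint_scal Rad c _ (circle_cont_weight f Hf)).
  apply oint_ext; [lra|]; intros; ring.
Qed.

Lemma circle_cont_inv_pow (k : nat) : circle_cont Rad (fun l => / l ^ k)%C.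
Proof.
  apply continuous_C_inv.
  - apply continuous_C_pow, continuous_circle.
  - intros t; apply Cpow_nz, (outside_nonzero rc); auto; rewrite Cmod_circle; lra.
Qed.

Lemma circle_cont_pole : circle_cont Rad (fun l => / (l * (1 - RtoC (4 * rc) / l)))%C.
Proof.
  assert (H : circle_cont Rad (fun l => 1 / (l + RtoC (- (4 * rc))))%C).
  { apply circle_cont_div; [lra | apply circle_cont_const | |].
    - apply circle_cont_plus; [apply circle_cont_id | apply circle_cont_const].
    - intros l Hl; rewrite RtoC_opp; apply outside_minus_nonzero; auto;
        now apply circle_outside. }
  revert H; apply circle_cont_ext; [lra|]; intros l Hl.
  assert (Hl' := circle_outside l Hl).
  assert (H0 := outside_nonzero rc Hrc l Hl'); assert (H1 := outside_minus_nonzero rc l Hrc Hl').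
  rewrite RtoC_opp; set (q := RtoC (4 * rc)) in *; field; repeat split; auto.
Qed.

Lemma moment_1 : oint Rad (fun l => Vlam p g2 l / wc rc l)%C = moment 1.
Proof.
  apply oint_ext; [lra|]; intros l Hl; assert (Hl' := circle_outside l Hl).
  assert (H0 := outside_nonzero rc Hrc l Hl'); assert (H1 := wc_nonzero rc l Hrc Hl').
  rewrite Cpow_1_r; field; auto.
Qed.

(** By w_c^2 = l (l - 4 rc) the integrand is V_lambda (l/w_c) (1/l^k - 4 rc/l^(k+1)). The
    criticality conditions thus become a two-term recursion for the moments. *)
Lemma critical_moment (k : nat) :
  oint Rad (fun l => (l - RtoC (4 * rc)) ^ S k * Vlam p g2 l / wc rc l ^ (2 * k + 1))%C
  = (moment k - RtoC (4 * rc) * moment (S k))%C.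
Proof.
  transitivity (moment k + RtoC (- (4 * rc)) * moment (S k))%C; [|rewrite RtoC_opp; ring].
  unfold moment; rewrite <- pairing_scal by apply circle_cont_inv_pow.
  rewrite <- pairing_plus; [| apply circle_cont_inv_pow |
    apply circle_cont_mult; [apply circle_cont_const | apply circle_cont_inv_pow]].
  apply oint_ext; [lra|]; intros l Hl; assert (Hl' := circle_outside l Hl).
  assert (H0 := outside_nonzero rc Hrc l Hl'); assert (H1 := wc_nonzero rc l Hrc Hl').
  assert (H2 := outside_minus_nonzero rc l Hrc Hl').
  rewrite Cpow_add_r, Cpow_mult_r, Cpow_1_r.
  replace (wc rc l ^ 2)%C with (wc rc l * wc rc l)%C by ring.
  rewrite wc_sqr, Cpow_mult_l, !Cpow_S, RtoC_opp by auto.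
  set (y := (l - RtoC (4 * rc))%C) in *.
  replace (RtoC (4 * rc)) with (l - y)%C by (unfold y; ring).
  assert (Hlk := Cpow_nz l k H0); assert (Hyk := Cpow_nz y k H2).
  field; auto.
Qed.

(** Both weights are (l/w_c)/(l - 4 rc). The nonvanishing of this integral is what lets the string
    equation detect the coefficient of the pole. *)
Lemma pole_pairing :
  oint Rad (fun l => l ^ 2 * Vlam p g2 l / wc rc l ^ 3)%C
  = pairing (fun l => / (l * (1 - RtoC (4 * rc) / l)))%C.
Proof.
  apply oint_ext; [lra|]; intros l Hl; assert (Hl' := circle_outside l Hl).
  assert (H0 := outside_nonzero rc Hrc l Hl'); assert (H1 := wc_nonzero rc l Hrc Hl').
  assert (H2 := outside_minus_nonzero rc l Hrc Hl').
  replace (wc rc l ^ 3)%C with ((wc rc l * wc rc l) * wc rc l)%C by ring.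
  rewrite wc_sqr by auto.
  set (q := RtoC (4 * rc)) in *; field; repeat split; auto.
Qed.

(* [1/(l^2 D) = (1/(l D) - 1/l) / (4 rc)] for [D = 1 - 4 rc / l]. *)
Lemma double_pole_pairing :
  moment 1 = 0%C ->
  pairing (fun l => / (l * (l * (1 - RtoC (4 * rc) / l))))%C
  = (pairing (fun l => / (l * (1 - RtoC (4 * rc) / l))) / RtoC (4 * rc))%C.
Proof.
  intros M1.
  assert (Hq : RtoC (4 * rc) <> 0%C) by (intros Z; apply RtoC_inj in Z; lra).
  transitivity (/ RtoC (4 * rc) * pairing (fun l => / (l * (1 - RtoC (4 * rc) / l)))
    + (- / RtoC (4 * rc)) * moment 1)%C; [|rewrite M1; unfold Cdiv; ring].
  unfold moment; rewrite <- !pairing_scal by (apply circle_cont_pole || apply circle_cont_inv_pow).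
  rewrite <- pairing_plus; [ | apply circle_cont_mult; [apply circle_cont_const | apply circle_cont_pole]
    | apply circle_cont_mult; [apply circle_cont_const | apply circle_cont_inv_pow]].
  apply pairing_ext; intros l Hl; assert (Hl' := circle_outside l Hl).
  assert (H0 := outside_nonzero rc Hrc l Hl').
  assert (H2 := outside_minus_nonzero rc l Hrc Hl').
  rewrite Cpow_1_r; set (q := RtoC (4 * rc)) in *; field; repeat split; auto.
Qed.

Section Polynomials.

Variables (a b : Rbar) (x : R).
Hypothesis Hx : Iopen a b x.

Lemma circle_cont_Pol (d : nat) (t : R -> R) (h : C -> R -> C) :
  Pol a b rc d t h -> circle_cont Rad (fun l => h l x).
Proof.
  revert h; induction d as [|d IH]; intros h.
  - intros [_ E]; apply (circle_cont_ext Rad (fun _ => RtoC (t x))); [lra| |apply circle_cont_const].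
    intros l Hl; symmetry; apply E; auto; now apply circle_outside.
  - intros (c & g & _ & Pg & E).
    apply (circle_cont_ext Rad (fun l => RtoC (c x) + g l x / l)%C); [lra| |].
    + intros l Hl; symmetry; apply E; auto; now apply circle_outside.
    + apply circle_cont_plus; [apply circle_cont_const|].
      apply circle_cont_div; [lra | now apply IH | apply circle_cont_id |].
      intros l Hl; apply (outside_nonzero rc); auto; now apply circle_outside.
Qed.

Variable m : nat.
Hypothesis Hmom : forall k, (1 <= k <= m)%nat -> moment k = 0%C.

(** The offset [j] lets the induction peel off the constant coefficient and divide by [l]. Every
    peeled coefficient meets a vanishing moment; the top one may meet the moment of index [m+1]. *)
Lemma pairing_Pol_shift (d j : nat) (t : R -> R) (h : C -> R -> C) :
  Pol a b rc d t h -> (j + d <= m)%nat ->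
  pairing (fun l => h l x * / l ^ S j)%C = (RtoC (t x) * moment (S (j + d)))%C.
Proof.
  revert j h; induction d as [|d IH]; intros j h.
  - intros [_ E] Hj; rewrite Nat.add_0_r; unfold moment.
    rewrite <- pairing_scal by apply circle_cont_inv_pow.
    apply pairing_ext; intros l Hl; rewrite E; auto; now apply circle_outside.
  - intros (c & g & _ & Pg & E) Hj.
    transitivity (RtoC (c x) * moment (S j) + pairing (fun l => g l x * / l ^ S (S j)))%C.
    + unfold moment; rewrite <- pairing_scal by apply circle_cont_inv_pow.
      rewrite <- pairing_plus.
      * apply pairing_ext; intros l Hl; rewrite E by (auto; now apply circle_outside).
        assert (H0 := outside_nonzero rc Hrc l (circle_outside l Hl)).
        rewrite !Cpow_S; assert (Hlj := Cpow_nz l j H0); field; auto.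
      * apply circle_cont_mult; [apply circle_cont_const | apply circle_cont_inv_pow].
      * apply circle_cont_mult; [now apply (circle_cont_Pol d t) | apply circle_cont_inv_pow].
    + rewrite Hmom, (IH (S j)) by (auto; lia).
      replace (j + S d)%nat with (S j + d)%nat by lia; ring.
Qed.

Lemma pairing_Pol (d : nat) (t : R -> R) (h : C -> R -> C) :
  Pol a b rc d t h -> (d <= m)%nat ->
  pairing (fun l => h l x / l)%C = (RtoC (t x) * moment (S d))%C.
Proof.
  intros Ph Hd; etransitivity; [|exact (pairing_Pol_shift d 0 t h Ph Hd)].
  apply pairing_ext; intros l Hl; now rewrite Cpow_1_r.
Qed.

Lemma circle_cont_Pol_div (d : nat) (t : R -> R) (h : C -> R -> C) :
  Pol a b rc d t h -> circle_cont Rad (fun l => h l x / l)%C.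
Proof.
  intros Ph; apply circle_cont_div; [lra | now apply (circle_cont_Pol d t) | apply circle_cont_id |].
  intros l Hl; apply (outside_nonzero rc); auto; now apply circle_outside.
Qed.

Lemma pairing_pole (d : nat) (t : R -> R) (f : C -> C) (h : C -> R -> C) (c : R) :
  Pol a b rc d t h -> (d <= m)%nat ->
  (forall l, 4 * rc < Cmod l ->
     (l * f l = h l x + RtoC c / (1 - RtoC (4 * rc) / l))%C) ->
  pairing f = (RtoC (t x) * moment (S d)
     + RtoC c * pairing (fun l => / (l * (1 - RtoC (4 * rc) / l))))%C.
Proof.
  intros Ph Hd E.
  rewrite <- (pairing_Pol d t h Ph Hd), <- pairing_scal, <- pairing_plus.
  - apply pairing_ext; intros l Hl; assert (Hl' := circle_outside l Hl).
    assert (H0 := outside_nonzero rc Hrc l Hl').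
    assert (HD := dom_factor_nonzero rc Hrc l Hl').
    transitivity ((l * f l) / l)%C; [field; auto|]; rewrite E by auto.
    set (D := (1 - RtoC (4 * rc) / l)%C) in *; field; auto.
  - now apply (circle_cont_Pol_div d t).
  - apply circle_cont_mult; [apply circle_cont_const | apply circle_cont_pole].
  - apply circle_cont_pole.
Qed.

Lemma pairing_double_pole (d : nat) (t : R -> R) (f : C -> C) (h : C -> R -> C) (c : R) :
  Pol a b rc d t h -> (1 <= m)%nat -> (d <= m)%nat ->
  (forall l, 4 * rc < Cmod l ->
     (l * f l = h l x + RtoC c / (l * (1 - RtoC (4 * rc) / l)))%C) ->
  pairing f = (RtoC (t x) * moment (S d)
     + RtoC c * (pairing (fun l => / (l * (1 - RtoC (4 * rc) / l))) / RtoC (4 * rc)))%C.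
Proof.
  intros Ph Hm Hd E.
  assert (CD : circle_cont Rad (fun l => / (l * (l * (1 - RtoC (4 * rc) / l))))%C).
  { apply (circle_cont_ext Rad (fun l => / l ^ 1 * / (l * (1 - RtoC (4 * rc) / l)))%C); [lra| |].
    - intros l Hl; assert (Hl' := circle_outside l Hl).
      assert (H0 := outside_nonzero rc Hrc l Hl').
      assert (HD := dom_factor_nonzero rc Hrc l Hl').
      rewrite Cpow_1_r; set (D := (1 - RtoC (4 * rc) / l)%C) in *; field; auto.
    - apply circle_cont_mult; [apply circle_cont_inv_pow | apply circle_cont_pole]. }
  rewrite <- double_pole_pairing by (apply Hmom; lia).
  rewrite <- (pairing_Pol d t h Ph Hd), <- pairing_scal by exact CD.
  rewrite <- pairing_plus by
    (exact (circle_cont_Pol_div d t h Ph)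
     || exact (circle_cont_mult Rad _ _ (circle_cont_const Rad (RtoC c)) CD)).
  apply pairing_ext; intros l Hl; assert (Hl' := circle_outside l Hl).
  assert (H0 := outside_nonzero rc Hrc l Hl').
  assert (HD := dom_factor_nonzero rc Hrc l Hl').
  transitivity ((l * f l) / l)%C; [field; auto|]; rewrite E by auto.
  set (D := (1 - RtoC (4 * rc) / l)%C) in *; field; auto.
Qed.

End Polynomials.

End Moments.

(** * Differential polynomials along the jet of a function *)

Section Jets.

Variables (a b : Rbar) (u : R -> R).
Notation I := (Iopen a b).
Hypothesis Hu : smooth_on I u.

Lemma smooth_on_deval_jet (P : dpoly) : smooth_on I (fun x => deval P (jet u x)).
Proof.
  induction P as [c|i|P IHP Q IHQ|P IHP Q IHQ]; simpl.
  - apply smooth_on_const.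
  - now apply smooth_on_Derive_n.
  - now apply smooth_on_plus.
  - now apply smooth_on_mult.
Qed.

Lemma Derive_deval_jet (P : dpoly) (x : R) :
  I x -> Derive (fun x => deval P (jet u x)) x = deval (dD P) (jet u x).
Proof.
  intros Hx; rewrite dD_ddir; apply is_derive_unique.
  apply (is_derive_deval P (fun i t => Derive_n u i t) (fun i => jet u x (S i)) x).
  intros i; apply Derive_correct, (Hu (S i) x Hx).
Qed.

Lemma Derive_2_deval_jet (P : dpoly) (x : R) :
  I x -> Derive_n (fun x => deval P (jet u x)) 2 x = deval (dD (dD P)) (jet u x).
Proof.
  intros Hx; rewrite <- Derive_deval_jet by assumption.
  apply (Derive_n_ext_on a b _ _ 1); [|assumption].
  intros y Hy; now apply Derive_deval_jet.
Qed.

End Jets.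

(** * Normalisation of the resolvent by a factor independent of [x] *)

Section Scaling.

Variables (a b : Rbar) (l v : C) (VV : nat -> C -> R -> C) (aa : nat -> R -> R) (x : R).
Hypothesis HVV : forall k, Csmooth_on (Iopen a b) (VV k l).
Hypothesis Hx : Iopen a b x.

(** The factor [v] is fixed together with [l], so it passes through all [x]-derivatives of the
    shift. *)
Lemma symm_scal (F : nat -> C -> R -> C) (c : R) (j : nat) :
  (forall k y, F k l y = (v * VV k l y)%C) ->
  symm c F j l x = (v * symm c VV j l x)%C.
Proof.
  intros E; unfold symm, shift_coef.
  rewrite E, Cmult_plus_distr_l; f_equal.
  etransitivity; [|apply (sum_n_mult_l (K := C_Ring))].
  apply sum_n_ext; intros k.
  rewrite (CDerive_n_ext a b _ (fun y => v * VV k l y)%C) by auto.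
  rewrite (CDerive_n_scal a b) by auto.
  change (@mult C_Ring) with Cmult; change (fun y => VV k l y) with (VV k l).
  ring_in C.
Qed.

Lemma cconv_scal (f g : nat -> C) (n : nat) :
  cconv (fun j => v * f j)%C (fun j => v * g j)%C n = (v * v * cconv f g n)%C.
Proof.
  unfold cconv; etransitivity; [|apply (sum_n_mult_l (K := C_Ring))].
  apply sum_n_ext; intros k; change (@mult C_Ring) with Cmult.
  ring_in C.
Qed.

Lemma lhs_coef_scal (F : nat -> C -> R -> C) (N : nat) :
  (forall k y, F k l y = (v * VV k l y)%C) ->
  lhs_coef aa F N l x = (v * v * lhs_coef aa VV N l x)%C.
Proof.
  intros E; rewrite !lhs_coef_cconv.
  unfold cconv at 1 3; etransitivity; [|apply (sum_n_mult_l (K := C_Ring))].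
  apply sum_n_ext; intros i; change (@mult C_Ring) with Cmult.
  rewrite (cconv_ext (fun j => symm (-1) F j l x) (fun j => symm 1 F j l x)
     (fun j => v * symm (-1) VV j l x)%C (fun j => v * symm 1 VV j l x)%C)
    by (intros; now apply symm_scal).
  rewrite cconv_scal.
  ring_in C.
Qed.

Lemma quad_coef_scal (F : nat -> C -> R -> C) (N : nat) :
  (forall k y, F k l y = (v * VV k l y)%C) ->
  quad_coef F N l x = (v * v * quad_coef VV N l x)%C.
Proof.
  intros E; unfold quad_coef.
  rewrite (cconv_ext _ _ (fun i => v * VV i l x)%C (fun i => v * VV i l x)%C)
    by (intros; apply E).
  rewrite cconv_scal; ring.
Qed.

End Scaling.

Theorem theorem3
  (p : nat) (g2 : nat -> R) (rc Rad : R) (m : nat)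
  (a b : Rbar) (aa : nat -> R -> R) (VV : nat -> C -> R -> C) :
  (1 <= p)%nat -> 0 < g2 p -> 0 < rc -> 4 * rc < Rad -> (1 <= m)%nat ->
  (* criticality conditions *)
  oint Rad (fun l => (Vlam p g2 l / wc rc l)%C) = 0%C ->
  (forall k, (1 <= k <= m - 1)%nat ->
     oint Rad (fun l => ((l - RtoC (4 * rc)) ^ (S k) * Vlam p g2 l
                         / (wc rc l) ^ (2 * k + 1))%C) = 0%C) ->
  oint Rad (fun l => ((l - RtoC (4 * rc)) ^ (S m) * Vlam p g2 l
                      / (wc rc l) ^ (2 * m + 1))%C) <> 0%C ->
  oint Rad (fun l => (l ^ 2 * Vlam p g2 l / (wc rc l) ^ 3)%C) <> 0%C ->
  (* the interval and the formal series *)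
  Rbar_lt a b ->
  (forall x, aa 0%nat x = rc) ->
  (forall k, (1 <= k)%nat -> smooth_on (Iopen a b) (aa k)) ->
  (forall k x l, Iopen a b x -> 4 * rc < Cmod l ->
     ex_derive (fun z : C => VV k z x) l) ->
  (forall k l, 4 * rc < Cmod l -> Csmooth_on (Iopen a b) (VV k l)) ->
  (forall x l, Iopen a b x -> 4 * rc < Cmod l ->
     VV 0%nat l x = (l / wc rc l)%C) ->
  (* the double-scaled string equations *)
  (forall N x l, Iopen a b x -> 4 * rc < Cmod l ->
     lhs_coef aa VV N l x = rhs_coef VV N l x) ->
  (forall N x, Iopen a b x ->
     oint Rad (fun l => (Vlam p g2 l * VV N l x)%C)
     = ((if Nat.eqb N 0 then oint Rad (fun l => (l * Vlam p g2 l / wc rc l)%C) else 0)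
        + (if Nat.eqb N (2 * m) then RtoC x else 0))%C) ->
  (* conclusion: Painleve II hierarchy for u = aa 1 *)
  forall Rs Ss : nat -> dpoly, RS_sequences rc Rs Ss ->
  forall x, Iopen a b x ->
    (RtoC (2 * rc)
     * oint Rad (fun l => ((l - RtoC (4 * rc)) ^ (S m) * Vlam p g2 l
                           / (wc rc l) ^ (2 * m + 1))%C)
     * RtoC (deval (Rs m) (jet (aa 1%nat) x))
     + RtoC (x * aa 1%nat x))%C = 0%C.
Proof.
  intros _ _ Hrc HRad Hm Hc0 Hck _ Hpsi _ Ha0 Ha _ HVs HV0 Hstr Hint Rs Ss HRS x Hx.
  rewrite moment_1 in Hc0 by assumption.
  assert (Hq : RtoC (4 * rc) <> 0%C) by (intros Z; apply RtoC_inj in Z; lra).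
  (* Once the moment [k] is zero, [critical_moment] reduces the condition of index [k] to the
     vanishing of the moment [k+1]. *)
  assert (Hmom : forall k, (1 <= k <= m)%nat -> moment p g2 rc Rad k = 0%C).
  { intros k; induction k as [|k IH]; intros Hk; [lia|].
    destruct k as [|k]; [exact Hc0|].
    assert (E := Hck (S k) ltac:(lia)).
    rewrite critical_moment, IH in E by (assumption || lia).
    transitivity (- (0 - RtoC (4 * rc) * moment p g2 rc Rad (S (S k))) / RtoC (4 * rc))%C;
      [field; auto | rewrite E; field; auto]. }
  rewrite pole_pairing in Hpsi by assumption.
  rewrite critical_moment, (Hmom m) by (assumption || lia).
  set (psi := pairing p g2 rc Rad (fun l => / (l * (1 - RtoC (4 * rc) / l)))%C) in *.
  set (u := aa 1%nat).
  assert (Hu : smooth_on (Iopen a b) u) by (apply Ha; lia).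
  set (s := fun k y => deval (sP rc Ss k) (jet u y)).
  set (r := fun k y => deval (rP rc Rs k) (jet u y)).
  set (F := fun k l y => (wc rc l / l * VV k l y)%C).
  assert (Hrho : forall j, rho r j = fun y => deval (rhoP rc Rs j) (jet u y))
    by (now intros [|j]).
  assert (Hs0 : forall y, s 0%nat y = 1) by reflexivity.
  assert (Hr0 : forall y, r 0%nat y = 2 * aa 1%nat y).
  { intros y; destruct HRS as [HR0 _]; unfold r; simpl; rewrite HR0; unfold jet, u; simpl.
    field; lra. }
  assert (Hs : forall k, smooth_on (Iopen a b) (s k)) by (intros; now apply smooth_on_deval_jet).
  assert (Hr : forall k, smooth_on (Iopen a b) (r k)) by (intros; now apply smooth_on_deval_jet).
  assert (Hquad : forall k y, Iopen a b y ->
    csum (fun j l => 4 * rc * s j y * s l y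
                   - rc * Derive_n (rho r j) 1 y * Derive_n (rho r l) 1 y) (S k)
    = csum (fun i l => r i y * r l y) k).
  { intros k y Hy.
    etransitivity; [|exact (quadratic_integral rc Rs Ss Hrc HRS k (jet u y))].
    apply csum_ext; intros j l; rewrite !Hrho; simpl Derive_n.
    now rewrite !(Derive_deval_jet a b). }
  assert (Hlin : forall K y, Iopen a b y ->
    csum (fun j l => aa 1%nat y * (4 * s j y * s l y - Derive_n (rho r j) 1 y * Derive_n (rho r l) 1 y)
                   + rc * (2 * Derive_n (s j) 1 y * Derive_n (rho r l) 1 y
                           - 2 * Derive_n (rho r j) 2 y * s l y)) K
    = csum (fun j l => 2 * r j y * s l y) K).
  { intros K y Hy.
    etransitivity; [|exact (linear_integral rc Rs Ss Hrc HRS K (jet u y))].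
    apply csum_ext; intros j l; rewrite !Hrho, !(Derive_2_deval_jet a b) by assumption.
    unfold s; change (Derive_n ?f 1 y) with (Derive f y).
    now rewrite !(Derive_deval_jet a b). }
  assert (F0 : forall l y, 4 * rc < Cmod l -> Iopen a b y -> F 0%nat l y = 1%C).
  { intros l y Hl Hy; unfold F; rewrite HV0 by assumption.
    assert (H0 := outside_nonzero rc Hrc l Hl); assert (H1 := wc_nonzero rc l Hrc Hl).
    field; auto. }
  assert (Heq : forall N l y, (1 <= N)%nat -> 4 * rc < Cmod l -> Iopen a b y ->
    lhs_coef aa F N l y = quad_coef F N l y).
  { intros N l y HN Hl Hy.
    rewrite (lhs_coef_scal a b l (wc rc l / l) VV), (quad_coef_scal l (wc rc l / l) VV)
      by (auto; intros; now apply HVs).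
    f_equal; rewrite Hstr by assumption; unfold rhs_coef, quad_coef, cconv.
    destruct N; [lia|]; simpl Nat.eqb; cbv iota; ring. }
  assert (Hpair : forall N y, Iopen a b y -> (1 <= N)%nat ->
    pairing p g2 rc Rad (fun l => F N l y) = if Nat.eqb N (2 * m) then RtoC y else 0%C).
  { intros N y Hy HN.
    transitivity (oint Rad (fun l => (Vlam p g2 l * VV N l y)%C)).
    - apply oint_ext; [lra|]; intros l Hl; unfold F.
      assert (Hl' := circle_outside rc Rad HRad l Hl).
      assert (H0 := outside_nonzero rc Hrc l Hl'); assert (H1 := wc_nonzero rc l Hrc Hl').
      field; auto.
    - rewrite Hint by assumption; destruct N; [lia|]; simpl Nat.eqb at 1; cbv iota.
      destruct (Nat.eqb (S N) (2 * m)); ring. }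
  (* With [S K <= m] the polynomial part pairs to zero, and only the pole term is left. *)
  assert (Hpole : forall K c h, (S K <= m)%nat -> smooth_on (Iopen a b) c ->
     Pol a b rc K (s (S K)) h ->
     (forall l y, 4 * rc < Cmod l -> Iopen a b y ->
       (l * F (2 * S K)%nat l y = h l y + RtoC (c y) / (1 - RtoC (4 * rc) / l))%C) ->
     forall y, Iopen a b y ->
     (RtoC (c y) * psi)%C = if Nat.eqb (2 * S K) (2 * m) then RtoC y else 0%C).
  { intros K c h HK Sc Ph Eh y Hy.
    assert (E := pairing_pole p g2 rc Rad Hrc HRad a b y Hy m Hmom K _
      (fun l => F (2 * S K)%nat l y) h (c y) Ph ltac:(lia) (fun l Hl => Eh l y Hl Hy)).
    rewrite Hpair, (Hmom (S K)) in E by (assumption || lia).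
    rewrite E; fold psi; ring. }
  destruct m as [|k]; [lia|].
  destruct (structure_below a b rc aa s r Hrc Ha0 Ha Hs0 Hs Hr Hquad Hlin F F0 Heq (S k))
    as [He Ho].
  (* Below order [2m] the second string equation has right-hand side 0, and [psi] is nonzero. *)
  { intros K c h HK Sc Ph Eh y Hy.
    assert (E := Hpole K c h ltac:(lia) Sc Ph Eh y Hy).
    destruct (Nat.eqb_spec (2 * S K) (2 * S k)); [lia|].
    destruct (Req_dec (c y) 0) as [Z|Z]; [assumption|]; exfalso.
    apply (Cmult_neq_0 (RtoC (c y)) psi); auto.
    intros Z'; now apply Z, RtoC_inj. }
  destruct (step_even a b rc aa s r Hrc Ha0 Ha Hs0 Hs Hquad F F0 Heq k)
    as (c & h & Sc & Ph & Eh); [intros; apply He; lia | intros; apply Ho; lia |].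
  destruct (step_last a b rc aa s r Hrc Ha0 Ha Hs0 Hr0 Hs Hr Hlin F F0 Heq k c h)
    as (e & Pe & Ee); [intros; apply He; lia | intros; apply Ho; lia | assumption | assumption |].
  (* Order [2m] with [m = S k]: the pole coefficient satisfies c psi = x. *)
  assert (E1 := Hpole k c h (Nat.le_refl _) Sc Ph Eh x Hx).
  rewrite Nat.eqb_refl in E1.
  (* Order [2m+1]: 0 = r_m M + 2 u c psi/(4 rc), where M is the moment [m+1]. *)
  assert (E2 := pairing_double_pole p g2 rc Rad Hrc HRad a b x Hx (S k) Hmom (S k) _
      (fun l => F (2 * S k + 1)%nat l x) e (2 * aa 1%nat x * c x) Pe Hm ltac:(lia)
      (fun l Hl => Ee l x Hl Hx)).
  fold psi in E2; rewrite Hpair in E2 by (assumption || lia).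
  destruct (Nat.eqb_spec (2 * S k + 1) (2 * S k)); [lia|].
  fold u in E2; fold u.
  replace (deval (Rs (S k)) (jet u x)) with (- / (4 * rc) * r (S k) x)
    by (unfold r; simpl; field; lra).
  set (M := moment p g2 rc Rad (S (S k))) in *.
  (* With phi_m = -4 rc M, R_m = -r_m/(4 rc) and x = c psi, the claim is 2 rc times the relation
     [E2]. *)
  transitivity (RtoC (2 * rc) * (RtoC (r (S k) x) * M
    + RtoC (2 * u x * c x) * (psi / RtoC (4 * rc))))%C.
  2: rewrite <- E2; ring.
  rewrite (RtoC_mult x), <- E1, !RtoC_mult, RtoC_opp, RtoC_inv, !RtoC_mult by lra.
  rewrite RtoC_mult in Hq.
  assert (H2 : RtoC rc <> 0%C) by (intros Z; apply RtoC_inj in Z; lra).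
  assert (H4 : RtoC 4 <> 0%C) by (intros Z; apply RtoC_inj in Z; lra).
  replace (RtoC 4) with (RtoC 2 * RtoC 2)%C in * by (rewrite <- RtoC_mult; f_equal; ring).
  field; repeat split; auto.
Qed.
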